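(* Let $A$ be a Noetherian ring and let $B = \bigoplus_{i=1}^n A\cdot e_i$ be an $A$-algebra that is finite free of rank $n \geq 1$ as an $A$-module, with basis $e_1,\dots,e_n$. Let $S = \mathrm{Spec}\, A$ and $S' = \mathrm{Spec}\, B$. Then, under the identification $\mathcal{R}_{S'/S} \simeq \mathrm{Spec}\, A[x_1,\dots,x_n]$ determined by the basis, the scheme of monogenerators $\mathcal{M}_{S'/S} \subseteq \mathcal{R}_{S'/S}$ is the distinguished affine open subscheme $D(\mathcal{i}(e_1,\dots,e_n))$, where $\mathcal{i}(e_1,\dots,e_n) \in A[x_1,\dots,x_n]$ is the local index form of $S'/S$ with respect to $e_1,\dots,e_n$.
   Context: For an $S$-scheme $T$, $\mathcal{R}_{S'/S}(T)$ is the set of $T$-morphisms $S' \times_S T \to \mathbb{A}^1_T$, and $\mathcal{M}_{S'/S}(T) \subseteq \mathcal{R}_{S'/S}(T)$ is the subset of those that are closed immersions; both functors are representable by $S$-schemes, denoted by the same symbols. The identification $\mathcal{R}_{S'/S} \simeq \mathrm{Spec}\, A[x_1,\dots,x_n]$ is such that the universal morphism $S' \times_S \mathcal{R}_{S'/S} \to \mathbb{A}^1_{\mathcal{R}_{S'/S}}$ corresponds to the $A[x_1,\dots,x_n]$-algebra map $A[x_1,\dots,x_n,t] \to B[x_1,\dots,x_n]$ sending $t \mapsto \theta := x_1e_1 + \cdots + x_ne_n$. Local index form: for $1 \le i,j\le n$ let $a_{ij} \in A[x_1,\dots,x_n]$ be the unique elements with $\theta^{j-1} = \sum_{i=1}^n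 a_{ij} e_i$ in $B[x_1,\dots,x_n] = \bigoplus_i A[x_1,\dots,x_n]\cdot e_i$. The matrix of coefficients is $M(e_1,\dots,e_n) = [a_{ij}]_{1\le i,j\le n}$, and the local index form is $\mathcal{i}(e_1,\dots,e_n) = \det M(e_1,\dots,e_n) \in A[x_1,\dots,x_n]$. $D(f)$ denotes the open subscheme of $\mathrm{Spec}\,A[x_1,\dots,x_n]$ where $f$ is invertible. *)

(* Defs.v *)
From HB Require Import structures.
From mathcomp Require Import all_boot all_order all_algebra ring.
From mathcomp Require Import mathcomp_extra boolp classical_sets functions.
From mathcomp Require Import topology_structure initial_topology subtype_topology.
From mathcomp.multinomials Require Import mpoly.

Set Implicit Arguments.
Unset Strict Implicit.
Unset Printing Implicit Defensive.

Import GRing.Theory.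

Local Open Scope classical_set_scope.
Local Open Scope quotient_scope.
Local Open Scope ring_scope.

Section CommutativeAlgebra.
Variable R : comPzRingType.

Definition invertible (a : R) : Prop := exists b, a * b = 1.

(* The inverse of [a], and 0 when [a] is not invertible. *)
Definition inverse (a : R) : R :=
  if pselect (invertible a) is left h then projT1 (cid h) else 0.

Lemma inverseP (a : R) : invertible a -> a * inverse a = 1.
Proof. by rewrite /inverse; case: pselect => // h _; case: cid. Qed.

Lemma invertible1 : invertible 1.
Proof. by exists 1; rewrite mulr1. Qed.

Lemma invertibleM (a b : R) : invertible a -> invertible b -> invertible (a * b).
Proof. by move=> [c ac] [d bd]; exists (c * d); rewrite mulrACA ac bd mulr1. Qed.

Lemma mulIinv (s a b : R) : invertible s -> a * s = b * s -> a = b.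
Proof. by move=> [t st] e; rewrite -[a]mulr1 -[b]mulr1 -st !mulrA e. Qed.

Definition local_ring : Prop :=
  1 <> 0 :> R /\
  forall a b : R, ~ invertible a -> ~ invertible b -> ~ invertible (a + b).

Definition is_ideal (I : set R) : Prop :=
  [/\ I 0, forall a b, I a -> I b -> I (a + b) & forall r a, I a -> I (r * a)].

Definition is_prime_ideal (p : set R) : Prop :=
  [/\ is_ideal p, ~ p 1 & forall a b, p (a * b) -> p a \/ p b].

Definition noetherian_ring : Prop :=
  forall I : set R, is_ideal I ->
  exists (m : nat) (g : 'I_m -> R),
    I = [set a | exists c : 'I_m -> R, a = \sum_i c i * g i].

End CommutativeAlgebra.

Record mulset (R : comPzRingType) := MulSet {
  mulset_set :> R -> Prop;
  mulset1 : mulset_set 1;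
  mulsetM : forall a b, mulset_set a -> mulset_set b -> mulset_set (a * b) }.

Section Localization.
Variables (R : comPzRingType) (S : mulset R).

Definition denom : Type := {s : R | `[< S s >]}.
HB.instance Definition _ := Choice.on denom.

Definition Denom s (h : S s) : denom := exist _ s (asboolT h).

Lemma denomP (s : denom) : S (val s).
Proof. by case: s => s /= /asboolP. Qed.

Definition mul_denom (s t : denom) : denom := Denom (mulsetM (denomP s) (denomP t)).
Definition one_denom : denom := Denom (mulset1 S).

Definition pre_loc : Type := (R * denom)%type.
HB.instance Definition _ := Choice.on pre_loc.

Definition loc_rel (x y : pre_loc) : bool :=
  `[< exists2 u, S u & u * (x.1 * val y.2) = u * (y.1 * val x.2) >].

Lemma loc_rel_refl : reflexive loc_rel.
Proof. by move=> x; apply/asboolP; exists 1 => //; exact: mulset1. Qed.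

Lemma loc_rel_sym x y : loc_rel x y = loc_rel y x.
Proof.
by apply/asboolP/asboolP => -[u Su e]; exists u => //; rewrite e.
Qed.

Lemma loc_rel_trans : transitive loc_rel.
Proof.
move=> y x z /asboolP[u Su e] /asboolP[v Sv f]; apply/asboolP.
exists (u * v * val y.2).
  by apply: mulsetM; [exact: mulsetM|exact: denomP].
have -> : u * v * val y.2 * (x.1 * val z.2) = v * val z.2 * (u * (x.1 * val y.2)).
  by ring.
rewrite e.
have -> : v * val z.2 * (u * (y.1 * val x.2)) = u * val x.2 * (v * (y.1 * val z.2)).
  by ring.
by rewrite f /=; ring.
Qed.

Canonical loc_equiv := EquivRel loc_rel loc_rel_refl loc_rel_sym loc_rel_trans.

(* The localization S^-1 R. *)
Definition loc : Type := {eq_quot loc_rel}.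
HB.instance Definition _ : EqQuotient _ loc_rel loc := EqQuotient.on loc.
HB.instance Definition _ := Choice.on loc.

Definition mkfrac (a : R) (s : denom) : loc := \pi_loc ((a, s) : pre_loc).

Lemma mkfrac_eq a s b t : mkfrac a s = mkfrac b t <->
  exists2 u, S u & u * (a * val t) = u * (b * val s).
Proof.
split; last by move=> h; apply/eqmodP/asboolP.
by move=> /eqmodP /asboolP.
Qed.

Lemma locP (x : loc) : exists a s, x = mkfrac a s.
Proof. by elim/quotW: x => -[a s]; exists a, s. Qed.

Definition addl (x y : loc) : loc :=
  let: (a, s) := repr x in let: (b, t) := repr y in
  mkfrac (a * val t + b * val s) (mul_denom s t).
Definition oppl (x : loc) : loc := let: (a, s) := repr x in mkfrac (- a) s.
Definition mull (x y : loc) : loc :=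
  let: (a, s) := repr x in let: (b, t) := repr y in
  mkfrac (a * b) (mul_denom s t).

Lemma mkfrac_repr x : mkfrac (repr x).1 (repr x).2 = x.
Proof. by rewrite /mkfrac -surjective_pairing reprK. Qed.

Lemma addlE a s b t :
  addl (mkfrac a s) (mkfrac b t) = mkfrac (a * val t + b * val s) (mul_denom s t).
Proof.
rewrite /addl; have := mkfrac_repr (mkfrac a s); have := mkfrac_repr (mkfrac b t).
case: (repr _) => b' t'; case: (repr _) => a' s' /=.
move=> /mkfrac_eq[v Sv f] /mkfrac_eq[u Su e].
apply/mkfrac_eq; exists (u * v); first exact: mulsetM.
rewrite /=.
have -> : u * v * ((a' * sval t' + b' * sval s') * (sval s * sval t)) =
  v * sval t' * sval t * (u * (a' * sval s)) +
  u * sval s' * sval s * (v * (b' * sval t)) by ring.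
by rewrite e f /=; ring.
Qed.

Lemma opplE a s : oppl (mkfrac a s) = mkfrac (- a) s.
Proof.
rewrite /oppl; have := mkfrac_repr (mkfrac a s); case: (repr _) => a' s' /=.
move=> /mkfrac_eq[u Su e]; apply/mkfrac_eq; exists u => //.
by rewrite !mulNr !mulrN e.
Qed.

Lemma mullE a s b t :
  mull (mkfrac a s) (mkfrac b t) = mkfrac (a * b) (mul_denom s t).
Proof.
rewrite /mull; have := mkfrac_repr (mkfrac a s); have := mkfrac_repr (mkfrac b t).
case: (repr _) => b' t'; case: (repr _) => a' s' /=.
move=> /mkfrac_eq[v Sv f] /mkfrac_eq[u Su e].
apply/mkfrac_eq; exists (u * v); first exact: mulsetM.
rewrite /=.
have -> : u * v * (a' * b' * (sval s * sval t)) =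
  (u * (a' * sval s)) * (v * (b' * sval t)) by ring.
by rewrite e f /=; ring.
Qed.

Lemma mkfrac_eq1 a s b t : a * val t = b * val s -> mkfrac a s = mkfrac b t.
Proof. by move=> e; apply/mkfrac_eq; exists 1; rewrite ?e //; exact: mulset1. Qed.

Lemma addlA : associative addl.
Proof.
move=> x y z; have [a [s ->]] := locP x; have [b [t ->]] := locP y.
have [c [r ->]] := locP z; rewrite !addlE; apply: mkfrac_eq1; rewrite /=; ring.
Qed.

Lemma addlC : commutative addl.
Proof.
move=> x y; have [a [s ->]] := locP x; have [b [t ->]] := locP y.
by rewrite !addlE; apply: mkfrac_eq1; rewrite /=; ring.
Qed.

Lemma add0l : left_id (mkfrac 0 one_denom) addl.
Proof.
move=> x; have [a [s ->]] := locP x.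
by rewrite addlE; apply: mkfrac_eq1; rewrite /=; ring.
Qed.

Lemma addNl : left_inverse (mkfrac 0 one_denom) oppl addl.
Proof.
move=> x; have [a [s ->]] := locP x.
by rewrite opplE addlE; apply: mkfrac_eq1; rewrite /=; ring.
Qed.

HB.instance Definition _ := GRing.isZmodule.Build loc addlA addlC add0l addNl.

Lemma mullA : associative mull.
Proof.
move=> x y z; have [a [s ->]] := locP x; have [b [t ->]] := locP y.
have [c [r ->]] := locP z; rewrite !mullE; apply: mkfrac_eq1; rewrite /=; ring.
Qed.

Lemma mullC : commutative mull.
Proof.
move=> x y; have [a [s ->]] := locP x; have [b [t ->]] := locP y.
by rewrite !mullE; apply: mkfrac_eq1; rewrite /=; ring.
Qed.

Lemma mul1l : left_id (mkfrac 1 one_denom) mull.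
Proof.
move=> x; have [a [s ->]] := locP x.
by rewrite mullE; apply: mkfrac_eq1; rewrite /=; ring.
Qed.

Lemma mullDl : left_distributive mull addl.
Proof.
move=> x y z; have [a [s ->]] := locP x; have [b [t ->]] := locP y.
have [c [r ->]] := locP z.
rewrite addlE !mullE addlE; apply: mkfrac_eq1; rewrite /=; ring.
Qed.

HB.instance Definition _ :=
  GRing.Zmodule_isComPzRing.Build loc mullA mullC mul1l mullDl.

Lemma mkfracD a s b t :
  mkfrac a s + mkfrac b t = mkfrac (a * val t + b * val s) (mul_denom s t).
Proof. exact: addlE. Qed.

Lemma mkfracN a s : - mkfrac a s = mkfrac (- a) s.
Proof. exact: opplE. Qed.

Lemma mkfracM a s b t : mkfrac a s * mkfrac b t = mkfrac (a * b) (mul_denom s t).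
Proof. exact: mullE. Qed.

Lemma mkfrac0 : mkfrac 0 one_denom = 0. Proof. by []. Qed.
Lemma mkfrac1 : mkfrac 1 one_denom = 1. Proof. by []. Qed.

Definition toloc (a : R) : loc := mkfrac a one_denom.

Lemma toloc_zmod : zmod_morphism toloc.
Proof.
move=> a b; rewrite /toloc mkfracN mkfracD; apply: mkfrac_eq1; rewrite /=; ring.
Qed.

Lemma toloc_monoid : monoid_morphism toloc.
Proof.
split=> // a b; rewrite /toloc mkfracM; apply: mkfrac_eq1; rewrite /=; ring.
Qed.

HB.instance Definition _ := GRing.isZmodMorphism.Build R loc toloc toloc_zmod.
HB.instance Definition _ := GRing.isMonoidMorphism.Build R loc toloc toloc_monoid.

Lemma toloc_mkfrac a s : mkfrac a s * toloc (val s) = toloc a.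
Proof. by rewrite /toloc mkfracM; apply: mkfrac_eq1; rewrite /=; ring. Qed.

Lemma toloc_invertible s : S s -> invertible (toloc s).
Proof.
move=> Ss; exists (mkfrac 1 (Denom Ss)).
by rewrite mulrC toloc_mkfrac.
Qed.

Section Universal.
Variables (C : comPzRingType) (g : {rmorphism R -> C}).
Hypothesis gS : forall s, S s -> invertible (g s).

(* The homomorphism S^-1 R -> C, a/s |-> g(a) g(s)^-1, induced by a
   homomorphism g : R -> C that maps S to invertible elements. *)
Definition loc_lift (x : loc) : C :=
  g (repr x).1 * inverse (g (val (repr x).2)).

Lemma loc_liftE a s : loc_lift (mkfrac a s) * g (val s) = g a.
Proof.
rewrite /loc_lift; have := mkfrac_repr (mkfrac a s); case: (repr _) => a' s' /=.
move=> /mkfrac_eq[u Su e].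
have s'U := gS (denomP s').
apply: (mulIinv (invertibleM (gS Su) s'U)).
have -> : g a' * inverse (g (sval s')) * g (sval s) * (g u * g (sval s')) =
  (g u * (g a' * g (sval s))) * (g (sval s') * inverse (g (sval s'))) by ring.
rewrite (inverseP s'U) mulr1 -!rmorphM e !rmorphM; ring.
Qed.

Lemma loc_lift_toloc a : loc_lift (toloc a) = g a.
Proof. by rewrite -(loc_liftE a one_denom) /= rmorph1 mulr1. Qed.

Lemma loc_lift_zmod : zmod_morphism loc_lift.
Proof.
move=> x y; have [a [s ->]] := locP x; have [b [t ->]] := locP y.
rewrite mkfracN mkfracD.
have sU := gS (denomP s); have tU := gS (denomP t).
apply: (mulIinv (invertibleM sU tU)).
have -> : g (val s) * g (val t) = g (val (mul_denom s t)) by rewrite -rmorphM.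
rewrite loc_liftE /= !rmorphD !rmorphM !rmorphN -(loc_liftE a s) -(loc_liftE b t).
ring.
Qed.

Lemma loc_lift_monoid : monoid_morphism loc_lift.
Proof.
split; first by rewrite -[1]/(toloc 1) loc_lift_toloc rmorph1.
move=> x y; have [a [s ->]] := locP x; have [b [t ->]] := locP y.
rewrite mkfracM.
have sU := gS (denomP s); have tU := gS (denomP t).
apply: (mulIinv (invertibleM sU tU)).
have -> : g (val s) * g (val t) = g (val (mul_denom s t)) by rewrite -rmorphM.
rewrite loc_liftE /= !rmorphM -(loc_liftE a s) -(loc_liftE b t).
ring.
Qed.

Definition loc_hom : {rmorphism loc -> C} := HB.pack loc_lift
  (GRing.isZmodMorphism.Build loc C loc_lift loc_lift_zmod)
  (GRing.isMonoidMorphism.Build loc C loc_lift loc_lift_monoid).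

Lemma loc_homE a s : loc_hom (mkfrac a s) * g (val s) = g a.
Proof. exact: loc_liftE. Qed.

Lemma loc_hom_toloc a : loc_hom (toloc a) = g a.
Proof. exact: loc_lift_toloc. Qed.

End Universal.
End Localization.

Definition local_hom (R R' : comPzRingType) (f : {rmorphism R -> R'}) : Prop :=
  forall a, invertible (f a) -> invertible a.

(* A locally ringed space.  Its structure sheaf is given by its stalks and, for
   each open set U, by the subset [sections U] of the product of the stalks over
   the points of U: a sheaf of rings embeds, by taking germs, in the product of
   its stalks, and the subsets of that product that arise in this way are those
   described by the axioms below (the sheaf is the sheaf of sections of its
   etale space).  A section over U is represented by a function on the whole
   space, of which only the restriction to U matters ([sections_ext]). *)
Record lrspace := LRSpace {
  points :> topologicalType;
  stalk : points -> comPzRingType;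
  sections : set points -> (forall x, stalk x) -> Prop;
  sections_ext : forall (U : set points) s t, open U ->
    (forall x, U x -> s x = t x) -> sections U s -> sections U t;
  sections_restr : forall (U V : set points) s, open U -> open V -> V `<=` U ->
    sections U s -> sections V s;
  sections_glue : forall (U : set points) s, open U ->
    (forall x, U x -> exists V : set points, [/\ open V, V x & sections V s]) ->
    sections U s;
  sections1 : forall U : set points, open U -> sections U (fun=> 1);
  sectionsB : forall (U : set points) s t, open U ->
    sections U s -> sections U t -> sections U (fun x => s x - t x);
  sectionsM : forall (U : set points) s t, open U ->
    sections U s -> sections U t -> sections U (fun x => s x * t x);
  stalk_germ : forall x (a : stalk x), exists (U : set points) s,
    [/\ open U, U x, sections U s & s x = a];
  germ_eq : forall (U : set points) s t x, open U -> U x ->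
    sections U s -> sections U t -> s x = t x ->
    exists V : set points, [/\ open V, V x & forall y, V y -> s y = t y];
  stalk_local : forall x, local_ring (stalk x) }.

Arguments stalk : clear implicits.

(* The pullback of a function along a map of points and maps of stalks. *)
Definition pull (X Y : lrspace) (f : X -> Y)
    (fs : forall x, {rmorphism stalk Y (f x) -> stalk X x})
    (s : forall y, stalk Y y) : forall x, stalk X x :=
  fun x => fs x (s (f x)).

Record lrmor (X Y : lrspace) := LRMor {
  mor_fun :> X -> Y;
  mor_stalk : forall x, {rmorphism stalk Y (mor_fun x) -> stalk X x};
  mor_continuous : continuous mor_fun;
  mor_sections : forall (V : set Y) s, open V -> sections V s ->
    sections (mor_fun @^-1` V) (pull mor_stalk s);
  mor_local : forall x, local_hom (mor_stalk x) }.

Arguments mor_stalk {X Y} f x : rename.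

Definition mor_pull (X Y : lrspace) (f : lrmor X Y) := pull (mor_stalk f).

Lemma preimage_open (X Y : lrspace) (f : lrmor X Y) (V : set Y) :
  open V -> open (f @^-1` V).
Proof. by have /continuousP h := @mor_continuous _ _ f; exact: h. Qed.

Section Category.

Lemma id_local_hom (R : comPzRingType) : local_hom (idfun : {rmorphism R -> R}).
Proof. by []. Qed.

Definition lrid (X : lrspace) : lrmor X X :=
  @LRMor X X (fun x => x) (fun x => idfun : {rmorphism stalk X x -> stalk X x})
    (fun x => cvg_id) (fun V s oV h => h) (fun x => @id_local_hom _).

Variables (X Y Z : lrspace) (g : lrmor Y Z) (f : lrmor X Y).

Definition comp_stalk x : {rmorphism stalk Z (g (f x)) -> stalk X x} :=
  mor_stalk f x \o mor_stalk g (f x).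

Lemma comp_sections (V : set Z) s : open V -> sections V s ->
  sections ((g \o f) @^-1` V) (pull comp_stalk s).
Proof.
move=> oV sV; have gs := @mor_sections _ _ g V s oV sV.
exact: (@mor_sections _ _ f _ (mor_pull g s) (preimage_open g oV) gs).
Qed.

Lemma comp_continuous : continuous (g \o f).
Proof.
by move=> x; apply: continuous_comp; [exact: (@mor_continuous _ _ f)|exact: (@mor_continuous _ _ g)].
Qed.

Lemma comp_local x : local_hom (comp_stalk x).
Proof. by move=> a /mor_local/mor_local. Qed.

Definition lrcomp : lrmor X Z := LRMor comp_continuous comp_sections comp_local.

End Category.

(* The points of Spec R. *)
Record primespec (R : comPzRingType) := PrimeSpec {
  prime_set :> R -> Prop;
  primeP : is_prime_ideal prime_set }.

HB.instance Definition _ R := gen_eqMixin (primespec R).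
HB.instance Definition _ R := gen_choiceMixin (primespec R).

Section Zariski.
Variable R : comPzRingType.
Implicit Types (p : primespec R) (a b : R).

Lemma prime0 p : p 0. Proof. by have [[]] := primeP p. Qed.
Lemma prime1 p : ~ p 1. Proof. by have [] := primeP p. Qed.
Lemma primeD p a b : p a -> p b -> p (a + b).
Proof. by have [[_ + _] _ _] := primeP p; apply. Qed.
Lemma primeMr p a b : p b -> p (a * b).
Proof. by have [[_ _ +] _ _] := primeP p; apply. Qed.
Lemma primeM p a b : p (a * b) -> p a \/ p b.
Proof. by have [_ _ +] := primeP p; apply. Qed.

Definition prime_compl p : mulset R.
Proof.
exists (fun a => ~ p a); first exact: prime1.
by move=> a b pa pb /primeM[].
Defined.

(* The complement of the closed set V(E) of the primes that contain E. *)
Definition zariski_open : set_system (primespec R) :=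
  [set U | exists E : set R,
    U = [set p : primespec R | ~ (forall a, E a -> p a)]].

Lemma zariski_openT : zariski_open setT.
Proof.
exists setT; apply/seteqP; split=> // p _ /= h; exact: (@prime1 p (h 1 I)).
Qed.

Lemma zariski_openI : setI_closed zariski_open.
Proof.
move=> _ _ [E ->] [F ->].
exists [set x | exists a b, [/\ E a, F b & x = a * b]].
apply/seteqP; split=> p /=.
  move=> [/existsNP[a /not_implyP[Ea pa]] /existsNP[b /not_implyP[Fb pb]]] h.
  by have /primeM[] : p (a * b) by apply: h; exists a, b.
move=> h; split=> k; apply: h => _ [a [b [Ea Fb ->]]].
  by rewrite mulrC; apply: primeMr; exact: k.
by apply: primeMr; exact: k.
Qed.

Lemma zariski_open_bigU (J : Type) (f : J -> set (primespec R)) :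
  (forall i, zariski_open (f i)) -> zariski_open (\bigcup_i f i).
Proof.
move=> h; pose E i := projT1 (cid (h i)).
have fE i : f i = [set p : primespec R | ~ (forall a, E i a -> p a)] by rewrite /E; case: cid.
exists (\bigcup_i E i); apply/seteqP; split=> p /=.
  by move=> [i _]; rewrite fE /= => k l; apply: k => a Ea; apply: l; exists i.
move=> /existsNP[a /not_implyP[[i _ Ea] pa]].
by exists i => //; rewrite fE /= => k; apply: pa; exact: k.
Qed.

HB.instance Definition _ := isOpenTopological.Build (primespec R)
  zariski_openT zariski_openI zariski_open_bigU.

Lemma open_zariski (U : set (primespec R)) : open U <-> zariski_open U.
Proof. by []. Qed.

Definition basic_open (f : R) : set (primespec R) := [set p | ~ p f].

Lemma basic_open_open f : open (basic_open f).
Proof.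
apply/open_zariski; exists [set f]; apply/seteqP; split=> p /=.
  by move=> pf h; apply: pf; exact: h.
by move=> h pf; apply: h => _ ->.
Qed.

End Zariski.

Section Spec.
Variable R : comPzRingType.
Implicit Types (p q : primespec R) (U V : set (primespec R)).

Definition spec_stalk p : comPzRingType := loc (prime_compl p).

Definition spec_sections U (s : forall p, spec_stalk p) : Prop :=
  forall p, U p -> exists V : set (primespec R), [/\ open V, V p, V `<=` U &
    exists a f : R, forall q, V q ->
      exists fq : prime_compl q f, s q = mkfrac a (Denom fq)].

Lemma spec_ext U s t : open U -> (forall p, U p -> s p = t p) ->
  spec_sections U s -> spec_sections U t.
Proof.
move=> oU st sU p Up; have [V [oV Vp VU [a [f h]]]] := sU p Up.
exists V; split=> //; exists a, f => q Vq; have [fq e] := h q Vq.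
by exists fq; rewrite -st ?e //; exact: VU.
Qed.

Lemma spec_restr U V s : open U -> open V -> V `<=` U ->
  spec_sections U s -> spec_sections V s.
Proof.
move=> oU oV VU sU p Vp; have [W [oW Wp WU [a [f h]]]] := sU p (VU _ Vp).
exists (V `&` W); split; [exact: openI|by []|by move=> q []|].
by exists a, f => q [_ Wq]; exact: h.
Qed.

Lemma spec_glue U s : open U ->
  (forall p, U p -> exists V : set (primespec R),
     [/\ open V, V p & spec_sections V s]) -> spec_sections U s.
Proof.
move=> oU h p Up; have [V [oV Vp sV]] := h p Up.
have [W [oW Wp WV [a [f k]]]] := sV p Vp.
exists (U `&` W); split; [exact: openI|by []|by move=> q []|].
by exists a, f => q [_ Wq]; exact: k.
Qed.

Lemma spec1 U : open U -> spec_sections U (fun=> 1).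
Proof.
move=> oU p Up; exists U; split=> //; exists 1, 1 => q Uq.
by exists (@prime1 _ q); rewrite -mkfrac1; apply: mkfrac_eq1.
Qed.

Lemma specB U s t : open U -> spec_sections U s -> spec_sections U t ->
  spec_sections U (fun p => s p - t p).
Proof.
move=> oU sU tU p Up.
have [V [oV Vp VU [a [f h]]]] := sU p Up.
have [W [oW Wp WU [b [g k]]]] := tU p Up.
exists (V `&` W); split; [exact: openI|by []|by move=> q [/VU]|].
exists (a * g - b * f), (f * g) => q [/h[fq ->] /k[gq ->]].
exists (mulsetM fq gq).
by rewrite mkfracN mkfracD; apply: mkfrac_eq1; rewrite /= mulNr.
Qed.

Lemma specM U s t : open U -> spec_sections U s -> spec_sections U t ->
  spec_sections U (fun p => s p * t p).
Proof.
move=> oU sU tU p Up.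
have [V [oV Vp VU [a [f h]]]] := sU p Up.
have [W [oW Wp WU [b [g k]]]] := tU p Up.
exists (V `&` W); split; [exact: openI|by []|by move=> q [/VU]|].
exists (a * b), (f * g) => q [/h[fq ->] /k[gq ->]].
exists (mulsetM fq gq).
by rewrite mkfracM; exact: mkfrac_eq1.
Qed.

Lemma spec_germ p (x : spec_stalk p) : exists U s,
  [/\ open U, U p, spec_sections U s & s p = x].
Proof.
have [a [f ->]] := locP x.
pose s q : spec_stalk q :=
  if pselect (prime_compl q (val f)) is left fq then mkfrac a (Denom fq) else 0.
have sE q (fq : prime_compl q (val f)) : s q = mkfrac a (Denom fq).
  by rewrite /s; case: pselect => // fq'; apply: mkfrac_eq1.
exists (basic_open (val f)), s; split; first exact: basic_open_open.
- by have := denomP f.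
- move=> q fq; exists (basic_open (val f)).
  split=> //; first exact: basic_open_open.
  by exists a, (val f) => r fr; exists fr; exact: sE.
- by rewrite (sE _ (denomP f)); exact: mkfrac_eq1.
Qed.

Lemma spec_germ_eq U s t p : open U -> U p ->
  spec_sections U s -> spec_sections U t -> s p = t p ->
  exists V, [/\ open V, V p & forall q, V q -> s q = t q].
Proof.
move=> oU Up sU tU.
have [V [oV Vp VU [a [f h]]]] := sU p Up.
have [W [oW Wp WU [b [g k]]]] := tU p Up.
have [fp ->] := h p Vp; have [gp ->] := k p Wp.
move=> /mkfrac_eq[u up e].
exists (V `&` W `&` basic_open u); split.
- by apply: openI; [exact: openI|exact: basic_open_open].
- by [].
- move=> q [[/h[fq ->] /k[gq ->]] uq].
  by apply/mkfrac_eq; exists u.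
Qed.

Lemma spec_local p : local_ring (spec_stalk p).
Proof.
have invP a (s : denom (prime_compl p)) : p a -> ~ invertible (mkfrac a s).
  move=> pa [x]; have [b [t ->]] := locP x.
  rewrite mkfracM -mkfrac1 => /mkfrac_eq[u up] /=.
  rewrite mulr1 mul1r => e.
  have : p (u * (sval s * sval t)) by rewrite -e mulrA mulrC mulrA; apply: primeMr.
  by case/primeM => // /primeM[]; [exact: (denomP s)|exact: (denomP t)].
have invN a (s : denom (prime_compl p)) : ~ invertible (mkfrac a s) -> p a.
  move=> h; apply: contrapT => pa; apply: h.
  exists (mkfrac (val s) (Denom (pa : prime_compl p a))).
  by rewrite mkfracM -mkfrac1; apply: mkfrac_eq1; rewrite /=; ring.
split.
  move=> e; apply: (invP 0 (one_denom _)); first exact: prime0.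
  by rewrite mkfrac0 -e; exact: invertible1.
move=> x y; have [a [s ->]] := locP x; have [b [t ->]] := locP y.
move=> /invN pa /invN pb; rewrite mkfracD; apply: invP.
by apply: primeD; rewrite mulrC; apply: primeMr.
Qed.

Definition Spec : lrspace :=
  @LRSpace (primespec R) spec_stalk spec_sections spec_ext spec_restr spec_glue
    spec1 specB specM spec_germ spec_germ_eq spec_local.

End Spec.

Section SpecMap.
Variables (R R' : comPzRingType) (f : {rmorphism R -> R'}).

Lemma preimage_prime (p : Spec R') : is_prime_ideal (fun a => p (f a)).
Proof.
split; first split.
- by rewrite rmorph0; exact: prime0.
- by move=> a b pa pb; rewrite rmorphD; exact: primeD.
- by move=> r a pa; rewrite rmorphM; exact: primeMr.
- by rewrite rmorph1; exact: prime1.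
- by move=> a b; rewrite rmorphM => /primeM.
Qed.

Definition spec_fun (p : Spec R') : Spec R := PrimeSpec (preimage_prime p).

Definition to_stalk (p : Spec R') : {rmorphism R -> spec_stalk p} :=
  toloc (prime_compl p) \o f.

Lemma to_stalk_inv (p : Spec R') s :
  prime_compl (spec_fun p) s -> invertible (to_stalk p s).
Proof. by move=> ps; apply: (@toloc_invertible _ (prime_compl p)). Qed.

(* The local homomorphism from the localization of R at f^-1(p) to the
   localization of R' at p. *)
Definition spec_stalk_map (p : Spec R') :
    {rmorphism stalk (Spec R) (spec_fun p) -> stalk (Spec R') p} :=
  loc_hom (@to_stalk_inv p).

Lemma spec_stalk_mapE (p : Spec R') a s (fs : prime_compl p (f (val s))) :
  spec_stalk_map p (mkfrac a s) = mkfrac (f a) (Denom fs).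
Proof.
apply: (mulIinv (toloc_invertible fs)).
by rewrite (loc_homE (@to_stalk_inv p)) -[f (val s)]/(val (Denom fs)) toloc_mkfrac.
Qed.

Lemma spec_continuous : continuous spec_fun.
Proof.
apply/continuousP => _ [E ->]; exists (f @` E); apply/seteqP; split=> p /= h k.
  by apply: h => a Ea; apply: k; exists a.
by apply: h => _ [a Ea <-]; exact: k.
Qed.

Lemma spec_map_sections (V : set (Spec R)) s : open V -> sections V s ->
  sections (spec_fun @^-1` V) (pull spec_stalk_map s).
Proof.
move=> oV sV p Vp; have [W [oW Wp WV [a [g h]]]] := sV _ Vp.
exists (spec_fun @^-1` W); split=> //.
- by have /continuousP := spec_continuous; apply.
- by move=> q; exact: WV.
exists (f a), (f g) => q Wq; have [gq e] := h _ Wq.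
exists gq; rewrite /pull e; exact: spec_stalk_mapE.
Qed.

Lemma spec_map_local p : local_hom (spec_stalk_map p).
Proof.
move=> x; have [a [s ->]] := locP x.
rewrite (spec_stalk_mapE _ (denomP s : prime_compl p (f (val s)))) => -[y].
have [b [t ->]] := locP y.
rewrite mkfracM -mkfrac1 => /mkfrac_eq[u up] /=; rewrite mulr1 mul1r => e.
have pa : prime_compl (spec_fun p) a.
  move=> pa; have : p (u * (f (sval s) * sval t)).
    by rewrite -e mulrA mulrC mulrA; apply: primeMr; rewrite /= in pa.
  by case/primeM => // /primeM[]; [exact: (denomP s)|exact: (denomP t)].
exists (mkfrac (val s) (Denom pa)).
by rewrite mkfracM -mkfrac1; apply: mkfrac_eq1; rewrite /=; ring.
Qed.

Definition Spec_map : lrmor (Spec R') (Spec R) :=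
  LRMor spec_continuous spec_map_sections spec_map_local.

End SpecMap.

Section OpenSubspace.
Variables (X : lrspace) (U : set X) (oU : open U).
Implicit Types (V W : set (set_type U)).

Definition sub_stalk (x : U) : comPzRingType := stalk X (val x).

(* As U is open, the image in X of an open subset V of U is open, and the
   sections over V are those of X over this image. *)
Definition sub_sections V (s : forall x, sub_stalk x) : Prop :=
  exists2 t : forall x, stalk X x,
    sections (val @` V) t & forall x, V x -> s x = t (val x).

Lemma open_sub_image V : open V -> open (val @` V : set X).
Proof.
move=> [W oW <-].
have -> : (val @` (val @^-1` W : set U) : set X) = U `&` W.
  apply/seteqP; split=> x /=.
    by move=> [y Wy <-]; split=> //; exact: set_valP.
  by move=> [Ux Wx]; exists (exist _ x (mem_set Ux)).
exact: openI.
Qed.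

Lemma open_sub_preimage (W : set X) : open W -> open (val @^-1` W : set U).
Proof. by move=> oW; exists W. Qed.

Definition sub_extend (s : forall x : U, sub_stalk x) (x : X) : stalk X x :=
  if pselect (U x) is left Ux then s (exist _ x (mem_set Ux)) else 0.

Lemma sub_extendE s (x : U) : sub_extend s (val x) = s x.
Proof.
rewrite /sub_extend; case: pselect => [Ux|]; last by case; exact: set_valP.
by case: x Ux => x Ux' Ux /=; congr (s (exist _ _ _)); exact: bool_irrelevance.
Qed.

Lemma sub_sectionsE V s : open V ->
  sub_sections V s <-> sections (val @` V) (sub_extend s).
Proof.
move=> oV; split=> [[t tV st]|h].
  apply: (sections_ext _ _ tV); first exact: open_sub_image.
  by move=> _ [x Vx <-]; rewrite sub_extendE st.
by exists (sub_extend s) => // x _; rewrite sub_extendE.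
Qed.

Lemma sub_ext V s t : open V -> (forall x, V x -> s x = t x) ->
  sub_sections V s -> sub_sections V t.
Proof. by move=> oV st [r rV sr]; exists r => // x Vx; rewrite -st ?sr. Qed.

Lemma sub_restr V W s : open V -> open W -> W `<=` V ->
  sub_sections V s -> sub_sections W s.
Proof.
move=> oV oW WV [t tV st]; exists t; last by move=> x /WV /st.
apply: (sections_restr _ _ _ tV); [exact: open_sub_image..|exact: image_subset].
Qed.

Lemma sub_glue V s : open V ->
  (forall x, V x -> exists W, [/\ open W, W x & sub_sections W s]) ->
  sub_sections V s.
Proof.
move=> oV h; apply/sub_sectionsE => //; apply: sections_glue.
  exact: open_sub_image.
move=> _ [x Vx <-]; have [W [oW Wx sW]] := h x Vx.
exists (val @` W); split; [exact: open_sub_image|by exists x|].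
by apply/sub_sectionsE.
Qed.

Lemma sub1 V : open V -> sub_sections V (fun=> 1).
Proof.
by move=> oV; exists (fun=> 1) => //; apply: sections1; exact: open_sub_image.
Qed.

Lemma subB V s t : open V -> sub_sections V s -> sub_sections V t ->
  sub_sections V (fun x => s x - t x).
Proof.
move=> oV [s' sV se] [t' tV te]; exists (fun x => s' x - t' x).
  by apply: sectionsB => //; exact: open_sub_image.
by move=> x Vx; rewrite se // te.
Qed.

Lemma subM V s t : open V -> sub_sections V s -> sub_sections V t ->
  sub_sections V (fun x => s x * t x).
Proof.
move=> oV [s' sV se] [t' tV te]; exists (fun x => s' x * t' x).
  by apply: sectionsM => //; exact: open_sub_image.
by move=> x Vx; rewrite se // te.
Qed.

Lemma sub_germ x (a : sub_stalk x) : exists V s,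
  [/\ open V, V x, sub_sections V s & s x = a].
Proof.
have [W [t [oW Wx tW <-]]] := stalk_germ a.
exists (val @^-1` W), (fun y => t (val y)); split=> //.
  exact: open_sub_preimage.
exists t => //; apply: (sections_restr _ _ _ tW) => //.
  by apply: open_sub_image; exact: open_sub_preimage.
by move=> _ [y Wy <-].
Qed.

Lemma sub_germ_eq V s t x : open V -> V x ->
  sub_sections V s -> sub_sections V t -> s x = t x ->
  exists W, [/\ open W, W x & forall y, W y -> s y = t y].
Proof.
move=> oV Vx /(sub_sectionsE _ oV) sV /(sub_sectionsE _ oV) tV st.
have [|||W [oW Wx h]] := germ_eq _ _ sV tV (x := val x).
- exact: open_sub_image.
- by exists x.
- by rewrite !sub_extendE.
exists (val @^-1` W); split=> //; first exact: open_sub_preimage.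
by move=> y /h; rewrite !sub_extendE.
Qed.

Definition open_subspace : lrspace :=
  @LRSpace U sub_stalk sub_sections sub_ext sub_restr sub_glue
    sub1 subB subM sub_germ sub_germ_eq (fun x => stalk_local (val x)).

Lemma incl_continuous : continuous (val : open_subspace -> X).
Proof. by apply/continuousP => W oW; exact: open_sub_preimage. Qed.

Lemma incl_sections (V : set X) s : open V -> sections V s ->
  sections ((val : open_subspace -> X) @^-1` V)
    (@pull open_subspace X val (fun x => idfun : {rmorphism stalk X (val x) -> _}) s).
Proof.
move=> oV sV; exists s => //; apply: (sections_restr _ _ _ sV) => //.
  by apply: open_sub_image; exact: open_sub_preimage.
by move=> _ [y Vy <-].
Qed.

Definition open_incl : lrmor open_subspace X :=
  LRMor incl_continuous incl_sections (fun x => @id_local_hom _).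

End OpenSubspace.

Definition lriso (X Y : lrspace) (f : lrmor X Y) : Prop :=
  exists g : lrmor Y X, lrcomp g f = lrid X /\ lrcomp f g = lrid Y.

Definition is_scheme (X : lrspace) : Prop :=
  forall x : X, exists (U : set X) (oU : open U), U x /\
    exists (R : comPzRingType) (f : lrmor (open_subspace oU) (Spec R)), lriso f.

(* A homeomorphism onto a closed subset such that O_Y -> f_* O_X is a surjective
   map of sheaves. *)
Definition closed_immersion (X Y : lrspace) (f : lrmor X Y) : Prop :=
  [/\ injective f,
      forall U : set X, open U -> exists2 V : set Y, open V & U = f @^-1` V,
      closed (range f) &
      forall (V : set Y) s, open V -> sections (f @^-1` V) s ->
        forall y, V y -> exists (W : set Y) t,
          [/\ open W, W y, W `<=` V, sections W t &
              forall x, W (f x) -> mor_pull f t x = s x]].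

(* A fibre product in the category of schemes. *)
Record fibre_product (X Y S : lrspace) (f : lrmor X S) (g : lrmor Y S) := FibreProduct {
  fp_obj :> lrspace;
  fp_scheme : is_scheme fp_obj;
  fp1 : lrmor fp_obj X;
  fp2 : lrmor fp_obj Y;
  fp_comm : lrcomp f fp1 = lrcomp g fp2;
  fp_univ : forall (Z : lrspace) (a : lrmor Z X) (b : lrmor Z Y),
    is_scheme Z -> lrcomp f a = lrcomp g b ->
    exists! h : lrmor Z fp_obj, lrcomp fp1 h = a /\ lrcomp fp2 h = b }.

Arguments fp1 {X Y S f g} _.
Arguments fp2 {X Y S f g} _.

(* The distinguished open subscheme D(f) of Spec R and its inclusion. *)
Definition distinguished_open (R : comPzRingType) (f : R) : lrspace :=
  @open_subspace (Spec R) _ (basic_open_open f).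

Definition distinguished_incl (R : comPzRingType) (f : R) :
    lrmor (distinguished_open f) (Spec R) :=
  @open_incl (Spec R) _ (basic_open_open f).

Lemma rmorph_ext (R R' : comPzRingType) (f g : {rmorphism R -> R'}) :
  f =1 g -> f = g.
Proof.
case: f => f [[hf] [mf]]; case: g => g [[hg] [mg]] /= fg.
have {}fg : f = g by apply/funext.
subst g; congr (GRing.RMorphism.Pack (GRing.RMorphism.Class _ _)).
  by congr Algebra.isNmodMorphism.Axioms_; exact: Prop_irrelevance.
by congr GRing.isMonoidMorphism.Axioms_; exact: Prop_irrelevance.
Qed.

Lemma lrmor_ext (X Y : lrspace) (f g : lrmor X Y) :
  (forall x, f x = g x) -> (forall s x, mor_pull f s x = mor_pull g s x) -> f = g.
Proof.
case: f => f fs fc fS fl; case: g => g gs gc gS gl /= fg.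
have {}fg : f = g by apply/funext.
subst g => h.
have {}h : fs = gs.
  apply: functional_extensionality_dep => x; apply: rmorph_ext => a.
  have [U [s [_ _ _ <-]]] := stalk_germ a; exact: h.
by subst gs; congr LRMor; exact: Prop_irrelevance.
Qed.

Section SpecScheme.
Variable R : comPzRingType.
Let X := open_subspace (@openT (Spec R)).

Let f (p : Spec R) : X := exist _ p (mem_set I).

Let f_continuous : continuous f.
Proof. by apply/continuousP => _ [W oW <-]. Qed.

Let f_sections (V : set X) s : open V -> sections V s ->
  sections (f @^-1` V) (pull (fun p => idfun : {rmorphism stalk X (f p) -> _}) s).
Proof.
move=> oV [t tV st].
have e : val @` V = f @^-1` V.
  apply/seteqP; split=> p /=; last by exists (f p).
  by move=> [q Vq <-]; have -> : f (val q) = q by exact: val_inj.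
rewrite -e; apply: (@sections_ext (Spec R) _ t _ _ _ tV).
  exact: (open_sub_image (@openT (Spec R)) oV).
by move=> p; rewrite e => Vp; exact: esym (st (f p) Vp).
Qed.

Let g : lrmor (Spec R) X :=
  LRMor f_continuous f_sections (fun p => @id_local_hom _).

Lemma Spec_is_scheme : is_scheme (Spec R).
Proof.
move=> p; exists setT, openT; split=> //; exists R, (open_incl _); exists g.
split; apply: lrmor_ext => //.
  by move=> x; exact: val_inj.
move=> s x; rewrite /mor_pull /pull /=.
by case: x => x Ux; have -> : Ux = mem_set I by exact: bool_irrelevance.
Qed.

End SpecScheme.

Section Monogenerators.
Variables (A : comNzRingType) (B : comAlgType A) (n : nat) (e : 'I_n -> B).

Definition is_basis : Prop :=
  forall b : B, exists! c : {ffun 'I_n -> A}, b = \sum_(i < n) c i *: e i.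

Local Notation Ax := {mpoly A[n]}.
Local Notation Bx := {mpoly B[n]}.

(* The canonical homomorphism A[x_1, .., x_n] -> B[x_1, .., x_n]. *)
Definition ext_hom : {rmorphism Ax -> Bx} := map_mpoly (GRing.in_alg B).

Definition theta : Bx := \sum_(i < n) 'X_i * (e i)%:MP.

(* Indices start at 0: the column j is given by the j-th power of theta. *)
Definition is_coefficient_matrix (M : 'M[Ax]_n) : Prop :=
  forall j : 'I_n, theta ^+ j = \sum_(i < n) ext_hom (M i j) * (e i)%:MP.

Lemma ext_hom_coef (q : Ax) (b : B) (m : 'X_{1..n}) :
  (ext_hom q * b%:MP)@_m = q@_m *: b.
Proof. by rewrite mulrC mcoeffCM mcoeff_map_mpoly /= mulrC mulr_algl. Qed.

Lemma coefficient_matrix_ex : is_basis ->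
  exists! M : 'M[Ax]_n, is_coefficient_matrix M.
Proof.
move=> he; pose c b := projT1 (cid (he b)).
have cE b : b = \sum_(i < n) c b i *: e i by rewrite /c; case: cid => x [].
have cU b (d : {ffun 'I_n -> A}) : b = \sum_(i < n) d i *: e i -> c b = d.
  by rewrite /c; case: cid => x [_ h] /= /h.
pose th (j : 'I_n) := theta ^+ j.
pose N := \matrix_(i, j) \sum_(m <- msupp (th j)) (c (th j)@_m i) *: 'X_[m] : 'M[Ax]_n.
have NE i j m : (N i j)@_m = c (th j)@_m i.
  rewrite mxE raddf_sum /=.
  have [mS|mS] := boolP (m \in msupp (th j)).
    rewrite (bigD1_seq m) //= ?msupp_uniq // mcoeffZ mcoeffX eqxx mulr1.
    rewrite big1 ?addr0 // => k /negPf km.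
    by rewrite mcoeffZ mcoeffX km mulr0.
  rewrite (memN_msupp_eq0 mS) (cU 0 0) ?ffunE; last first.
    by rewrite big1 // => k _; rewrite ffunE scale0r.
  rewrite big_seq big1 // => k kS; rewrite mcoeffZ mcoeffX.
  by case: eqP kS mS => [-> ->//|]; rewrite mulr0.
exists N; split.
  move=> j; apply/mpolyP => m; rewrite -/(th j) raddf_sum /=.
  rewrite {1}[(th j)@_m]cE; apply: eq_bigr => i _.
  by rewrite ext_hom_coef NE.
move=> M hM; apply/matrixP => i j; apply/mpolyP => m; rewrite NE.
have /cU -> : (th j)@_m = \sum_(i < n) [ffun i => (M i j)@_m] i *: e i.
  rewrite /th hM raddf_sum /=; apply: eq_bigr => k _.
  by rewrite ext_hom_coef ffunE.
by rewrite ffunE.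
Qed.

Definition coefficient_matrix : 'M[Ax]_n :=
  xget 0 [set M | is_coefficient_matrix M].

Lemma coefficient_matrixP :
  is_basis -> is_coefficient_matrix coefficient_matrix.
Proof.
move=> /coefficient_matrix_ex[M [hM _]].
exact: (@xgetPex _ 0 [set M | is_coefficient_matrix M]) (ex_intro _ M hM).
Qed.

Definition local_index_form : Ax := \det coefficient_matrix.

Definition univ_hom : {rmorphism {poly Ax} -> Bx} :=
  horner_morph (fun p : Ax => mulrC theta (ext_hom p)).

(* The ring B[x_1, .., x_n] defines the fibre product of S' = Spec B and
   R = Spec A[x_1, .., x_n] over S = Spec A, and A[x_1, .., x_n][t] the affine
   line over R.  The T-morphism m from S' x_S T to the affine line over T, i.e.
   the T-point m of the Weil restriction, corresponds to phi : T -> R when m is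
   the base change along phi of the universal morphism t |-> theta. *)
Definition corresponds (T : lrspace) (tau : lrmor T (Spec A))
    (S'T : fibre_product (Spec_map (GRing.in_alg B)) tau)
    (A1T : fibre_product (Spec_map (@polyC A)) tau)
    (m : lrmor S'T A1T) (phi : lrmor T (Spec Ax)) : Prop :=
  exists (phiS' : lrmor S'T (Spec Bx)) (phiA1 : lrmor A1T (Spec {poly Ax})),
  [/\ lrcomp (Spec_map (@mpolyC n B)) phiS' = fp1 S'T,
      lrcomp (Spec_map ext_hom) phiS' = lrcomp phi (fp2 S'T),
      lrcomp (Spec_map (map_poly (@mpolyC n A))) phiA1 = fp1 A1T,
      lrcomp (Spec_map (@polyC Ax)) phiA1 = lrcomp phi (fp2 A1T) &
      lrcomp (Spec_map univ_hom) phiS' = lrcomp phiA1 m].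

(* The S-morphism i : Mon -> Spec A[x_1, .., x_n] is the subscheme M of
   monogenerators of R. *)
Definition is_monogenerator_subscheme (Mon : lrspace)
    (i : lrmor Mon (Spec Ax)) : Prop :=
  forall (T : lrspace) (tau : lrmor T (Spec A))
    (S'T : fibre_product (Spec_map (GRing.in_alg B)) tau)
    (A1T : fibre_product (Spec_map (@polyC A)) tau)
    (m : lrmor S'T A1T) (phi : lrmor T (Spec Ax)),
  is_scheme T ->
  lrcomp (fp2 A1T) m = fp2 S'T ->
  lrcomp (Spec_map (@mpolyC n A)) phi = tau ->
  corresponds m phi ->
  closed_immersion m <-> exists psi : lrmor T Mon, lrcomp i psi = phi.

End Monogenerators.

(* Main.v *)
Require Import Defs.
From HB Require Import structures.
From mathcomp Require Import all_boot all_order all_algebra ring.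
From mathcomp Require Import boolp classical_sets topology_structure subtype_topology.
From mathcomp.multinomials Require Import mpoly.

Set Implicit Arguments.
Unset Strict Implicit.
Unset Printing Implicit Defensive.

Import GRing.Theory.

Local Open Scope classical_set_scope.
Local Open Scope ring_scope.

(** The question is local on [T].  Over an affine open [Spec C] of [T], on which
    [phi] is given by [c : A[x] -> C], the fibre products are the spectra of
    [B_C = B (x)_A C] and of [C[t]], and [m] is the spectrum of the homomorphism
    [psi : C[t] -> B_C] that maps [t] to the specialization of [theta]
    ([monogenerator_local]).  The statement comes down to three equivalences:

    - [m] is a closed immersion iff these homomorphisms [psi] are surjective
      ([closed_immersion_surj], [closed_immersion_local]);
    - [psi] is surjective iff [c] maps the local index form to a unit
      ([generator_det]).  By Cayley-Hamilton the image of [psi] is spanned over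
      [C] by the first [n] powers of [psi t], whose coordinates are the columns of
      the specialized coefficient matrix; they span the free module [B_C] iff the
      determinant of this matrix is a unit;
    - [c] maps the local index form to a unit for all these [C] iff [phi] takes
      its values in [D(i(e))], and then [phi] factors through this open subspace
      ([open_fact]).

    The reduction to rings rests on four facts: a section of the structure sheaf
    over all of [Spec R] is an element of [R] ([glob_surj]); a morphism from a
    locally ringed space to [Spec R] amounts to a homomorphism from [R] to global
    sections ([toSpec_ext], [toSpec]), so that [Spec] is fully faithful
    ([Spec_map_full], [Spec_map_faithful]); an open subspace of a scheme is a
    scheme ([open_subscheme]); and a fibre product given by its universal property
    is, above an affine open, the spectrum of a tensor product ([fibre_chart]).

    Open immersions are handled through the predicate [chart].  A statement about
    the stalks at [j y] is never transported along an equality of points: it is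
    read off families of germs pulled back along [j]. *)

(** * Prime ideals *)

Section PrimeIdeals.
Variable R : comPzRingType.
Implicit Types (I J : set R) (a b g h : R).

Lemma primespec_eq (p q : primespec R) : (forall a, p a <-> q a) -> p = q.
Proof.
case: p q => [p Pp] [q Pq] /= pq.
have {}pq : p = q by apply/funext => a; apply/propext.
by subst q; congr PrimeSpec; exact: Prop_irrelevance.
Qed.

Lemma prime_exp (p : primespec R) a n : p (a ^+ n) -> p a.
Proof.
elim: n => [|n IHn]; first by rewrite expr0 => /prime1.
by rewrite exprS => /primeM[].
Qed.

Lemma ideal_adjoin J a : is_ideal J ->
  is_ideal [set x | exists2 y, J y & exists r, x = y + r * a].
Proof.
move=> [J0 JD JM]; split.
- by exists 0 => //; exists 0; rewrite mul0r addr0.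
- move=> _ _ [y Jy [r ->]] [z Jz [s ->]]; exists (y + z); first exact: JD.
  by exists (r + s); ring.
- move=> t _ [y Jy [r ->]]; exists (t * y); first exact: JM.
  by exists (t * r); ring.
Qed.

(** A maximal element among the ideals that contain [I] and avoid the powers of
    [h] is prime: this is the usual argument by which the radical of an ideal is
    the intersection of the primes that contain it. *)
Lemma ideal_radical I h : is_ideal I ->
  (forall p : primespec R, I `<=` p -> p h) -> exists n, I (h ^+ n).
Proof.
move=> iI hp; apply: contrapT => nh.
pose good J := [/\ is_ideal J, I `<=` J & forall n, ~ J (h ^+ n)].
have goodI : good I by split=> // n Ihn; apply: nh; exists n.
(* The empty set is added as the union of the empty chain. *)
pose P : set (set R) := [set J | J = set0 \/ good J].
have [F FP Ftot|J [PJ Jmax]] := @Zorn_bigcup R P.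
  have [[J0 [FJ0 goodJ0]]|no] := pselect (exists J, F J /\ good J); last first.
    left; apply/seteqP; split=> // a [J FJ Ja].
    by case: (FP J FJ) => [JE|gJ]; [rewrite JE in Ja|case: no; exists J].
  right; split; last 2 first.
  - by move=> a Ia; exists J0 => //; case: goodJ0 => _ + _; apply.
  - move=> n [J FJ Jh]; case: (FP J FJ) => [JE|[_ _ /(_ n)]//].
    by rewrite JE in Jh.
  split.
  - by exists J0 => //; case: goodJ0 => -[].
  - move=> a b [J FJ Ja] [K FK Kb].
    have [JK|KJ] := Ftot J K FJ FK.
      case: (FP K FK) => [KE|[[_ KD _] _ _]]; first by rewrite KE in Kb.
      by exists K => //; apply: KD => //; exact: JK.
    case: (FP J FJ) => [JE|[[_ JD _] _ _]]; first by rewrite JE in Ja.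
    by exists J => //; apply: JD => //; exact: KJ.
  - move=> r a [J FJ Ja].
    case: (FP J FJ) => [JE|[[_ _ JM] _ _]]; first by rewrite JE in Ja.
    by exists J => //; apply: JM.
have {PJ} [iJ IJ Jh] : good J.
  case: PJ => // JE; exfalso; apply: (Jmax I); last by right.
  by rewrite JE; split=> // /(_ 0); apply; case: iI.
have [J0 JD JM] := iJ.
have big a : ~ J a -> exists n r y, J y /\ h ^+ n = y + r * a.
  move=> Ja; apply: contrapT => no.
  apply: (Jmax [set x | exists2 y, J y & exists r, x = y + r * a]).
    split=> [x Jx|/(_ a) JaE]; first by exists x => //; exists 0; ring.
    by apply: Ja; apply: JaE; exists 0 => //; exists 1; ring.
  right; split; first exact: ideal_adjoin.
    by move=> x Ix; exists x; [exact: IJ|exists 0; ring].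
  by move=> n [y Jy [r e]]; apply: no; exists n, r, y.
have pJ : is_prime_ideal J.
  split=> // [J1|a b Jab]; first by apply: (Jh 0); rewrite expr0.
  apply: contrapT => /not_orP[/big[n [r [y [Jy e]]]] /big[m [s [z [Jz f]]]]].
  apply: (Jh (n + m)%N); rewrite exprD e f.
  have -> : (y + r * a) * (z + s * b) =
    (z + s * b) * y + (r * a * z + r * s * (a * b)) by ring.
  by apply: (JD _ _ (JM _ _ Jy) (JD _ _ (JM _ _ Jz) (JM _ _ Jab))).
have : PrimeSpec pJ h by apply: hp.
by move=> Jh1; apply: (Jh 1%N); rewrite expr1.
Qed.

Lemma ideal1 I : is_ideal I ->
  (forall p : primespec R, exists2 a, I a & ~ p a) -> I 1.
Proof.
move=> iI h; have [|n] := @ideal_radical I 1 iI; last by rewrite expr1n.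
by move=> p Ip; have [a Ia pa] := h p; case: pa; exact: Ip.
Qed.

Lemma prime_unit a : (forall p : primespec R, ~ p a) -> invertible a.
Proof.
move=> h; have [||b] := @ideal1 [set x | exists b, x = a * b].
- split; first by exists 0; rewrite mulr0.
    by move=> _ _ [b ->] [c ->]; exists (b + c); rewrite mulrDr.
  by move=> r _ [b ->]; exists (r * b); ring.
- by move=> p; exists a => //; exists 1; rewrite mulr1.
- by move=> /= e; exists b.
Qed.

Lemma annihilator_ideal a : is_ideal [set u | u * a = 0].
Proof.
split=> [|u v /= ua va|r u /= ua]; first by rewrite /= mul0r.
  by rewrite mulrDl ua va addr0.
by rewrite -mulrA ua mulr0.
Qed.

Lemma stalk_eqP (p : Spec R) a b :
  toloc (prime_compl p) a = toloc (prime_compl p) b <->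
  exists2 u, ~ p u & u * (a - b) = 0.
Proof.
rewrite /toloc mkfrac_eq; split=> -[u pu] /=; rewrite ?mulr1 => e; exists u => //.
  by rewrite mulrBr e subrr.
by apply/eqP; rewrite -subr_eq0 -mulrBr e.
Qed.

(** The annihilator of [a - b] is contained in no prime of [D(h)], so it contains
    a power of [h]. *)
Lemma stalks_eq h a b :
  (forall p : Spec R, ~ p h -> toloc (prime_compl p) a = toloc (prime_compl p) b) ->
  exists n, h ^+ n * a = h ^+ n * b.
Proof.
move=> hab; have [|n] := ideal_radical (h := h) (annihilator_ideal (a - b)).
  move=> p pI; apply: contrapT => ph.
  by have /stalk_eqP[u pu /pI] := hab p ph.
by rewrite /= mulrBr => /eqP; rewrite subr_eq0 => /eqP ?; exists n.
Qed.

(** The global section of [Spec R] given by an element of [R]. *)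
Definition glob a : forall p : Spec R, stalk (Spec R) p :=
  fun p => toloc (prime_compl p) a.

Lemma glob_inj a b : (forall p, glob a p = glob b p) -> a = b.
Proof.
move=> h; have [|n] := @stalks_eq 1 a b; first by move=> p _; exact: h.
by rewrite expr1n !mul1r.
Qed.

Lemma glob_sections a (U : set (Spec R)) : open U -> sections U (glob a).
Proof.
move=> oU p Up; exists U; split=> //; exists a, 1 => q Uq.
by exists (@prime1 _ q); exact: mkfrac_eq1.
Qed.

Lemma basic_open_basis (U : set (Spec R)) p : open U -> U p ->
  exists2 h, ~ p h & forall q : Spec R, ~ q h -> U q.
Proof.
move=> [E ->] /existsNP[h /not_implyP[Eh ph]]; exists h => // q qh /= k.
by apply: qh; exact: k.
Qed.

Lemma mkfrac_glob (p : Spec R) (s : denom (prime_compl p)) a :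
  mkfrac a s * glob (val s) p = glob a p.
Proof. exact: toloc_mkfrac. Qed.

Lemma sections_basic (U : set (Spec R)) s p : open U -> sections U s -> U p ->
  exists a g h, [/\ ~ p h, forall q : Spec R, ~ q h -> U q /\ ~ q g &
    forall q : Spec R, ~ q h -> s q * glob g q = glob a q].
Proof.
move=> oU sU Up; have [V [oV Vp VU [a [g h]]]] := sU p Up.
have [k pk kV] := basic_open_basis oV Vp.
exists a, g, k; split=> // q /kV Vq; have [gq e] := h q Vq.
  by split=> //; exact: VU.
by rewrite e -[g]/(val (Denom gq)) mkfrac_glob.
Qed.

Lemma glob_invertible (p : Spec R) a : invertible (glob a p) <-> ~ p a.
Proof.
split=> [[x]|pa]; last exact: (@toloc_invertible _ (prime_compl p)).
have [b [t ->]] := locP x; rewrite /glob /toloc mkfracM -mkfrac1.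
move=> /mkfrac_eq[u pu] /=; rewrite mulr1 !mul1r => e pa.
have : p (u * val t) by rewrite -e mulrCA mulrC; exact: primeMr.
by case/primeM => //; exact: (denomP t).
Qed.

(** The elements [g] such that [s] restricts on [D(g)] to a fraction [a / g ^ k]
    form an ideal, and this ideal lies in no prime as [s] is locally a
    fraction. *)
Lemma glob_surj s : sections (setT : set (Spec R)) s ->
  exists a, forall p, s p = glob a p.
Proof.
move=> sT.
pose K0 : set R := [set g | exists k a,
  forall p : Spec R, ~ p g -> glob (g ^+ k) p * s p = glob a p].
suff [k [a h]] : K0 1.
  exists a => p; rewrite -(h p (@prime1 _ p)) expr1n.
  by rewrite /glob rmorph1 mul1r.
have globM a b p : glob (a * b) p = glob a p * glob b p by exact: rmorphM.
apply: ideal1 => [|p]; last first.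
  have [a [g [h [ph hU hs]]]] := sections_basic openT sT (I : setT p).
  exists (h * g); last by case/primeM => //; have [] := hU p ph.
  exists 1%N, (h * a) => q qhg.
  have qh : ~ q h by move=> qh; apply: qhg; rewrite mulrC; exact: primeMr.
  by rewrite expr1 !globM -(hs q qh); ring.
split.
- by exists 0%N, 0 => p; have := prime0 p.
- move=> g g' [k [a ha]] [k' [a' ha']].
  (* Both fractions agree on D(g g'), hence after multiplication by a power of
     g g'. *)
  have [|m e] := @stalks_eq (g * g') (g' ^+ k' * a) (g ^+ k * a').
    move=> p pgg.
    have pg : ~ p g by move=> pg; apply: pgg; rewrite mulrC; exact: primeMr.
    have pg' : ~ p g' by move=> pg'; apply: pgg; exact: primeMr.
    rewrite -![toloc _ _]/(glob _ _) !globM -(ha p pg) -(ha' p pg').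
    by ring.
  pose G := g ^+ (m + k); pose G' := g' ^+ (m + k').
  have GE (p : Spec R) : ~ p g -> glob G p * s p = glob (g ^+ m * a) p.
    by move=> pg; rewrite /G exprD !globM -(ha p pg); ring.
  have GE' (p : Spec R) : ~ p g' -> glob G' p * s p = glob (g' ^+ m * a') p.
    by move=> pg; rewrite /G' exprD !globM -(ha' p pg); ring.
  have GG : G' * (g ^+ m * a) = G * (g' ^+ m * a').
    have -> : G' * (g ^+ m * a) = (g * g') ^+ m * (g' ^+ k' * a).
      by rewrite /G' exprD exprMn; ring.
    by rewrite e /G exprD exprMn; ring.
  (* The ideal (G, G') contains a power of g + g', hence the two fractions
     combine to a single one whose denominator is this power. *)
  pose J : set R := [set x | exists u v, x = u * G + v * G'].
  have [|p Jp|N [u [v uv]]] := @ideal_radical J (g + g').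
  + split=> [|_ _ [u [v ->]] [u' [v' ->]]|r _ [u [v ->]]].
    * by exists 0, 0; ring.
    * by exists (u + u'), (v + v'); ring.
    * by exists (r * u), (r * v); ring.
  + apply: primeD; apply: prime_exp; apply: Jp.
      by exists 1, 0; rewrite mul1r mul0r addr0.
    by exists 0, 1; rewrite mul1r mul0r add0r.
  exists N, (u * (g ^+ m * a) + v * (g' ^+ m * a')) => p pgg.
  have [pg|pg'] : ~ p g \/ ~ p g'.
    by apply: contrapT => /not_orP[/contrapT pg /contrapT pg']; apply: pgg; exact: primeD.
  + have GU : invertible (glob G p) by apply/glob_invertible => /prime_exp.
    apply: (mulIinv GU); rewrite uv.
    transitivity (glob (u * G + v * G') p * glob (g ^+ m * a) p).
      by rewrite -(GE p pg); ring.
    by rewrite -!globM; congr (glob _ p); rewrite 2!mulrDl -!mulrA GG; ring.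
  + have GU : invertible (glob G' p) by apply/glob_invertible => /prime_exp.
    apply: (mulIinv GU); rewrite uv.
    transitivity (glob (u * G + v * G') p * glob (g' ^+ m * a') p).
      by rewrite -(GE' p pg'); ring.
    rewrite -!globM; congr (glob _ p); rewrite 2!mulrDl -!mulrA.
    by rewrite -GG; ring.
- move=> r g [k [a h]]; exists k, (r ^+ k * a) => p prg.
  have pg : ~ p g by move=> pg; apply: prg; exact: primeMr.
  by rewrite exprMn !globM -(h p pg); ring.
Qed.

End PrimeIdeals.

(** * Morphisms of locally ringed spaces *)

Lemma lrcompA (X Y Z W : lrspace) (h : lrmor Z W) (g : lrmor Y Z) (f : lrmor X Y) :
  lrcomp h (lrcomp g f) = lrcomp (lrcomp h g) f.
Proof. exact: lrmor_ext. Qed.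

Lemma lrcomp1f (X Y : lrspace) (f : lrmor X Y) : lrcomp (lrid Y) f = f.
Proof. exact: lrmor_ext. Qed.

Lemma lrcompf1 (X Y : lrspace) (f : lrmor X Y) : lrcomp f (lrid X) = f.
Proof. exact: lrmor_ext. Qed.

Lemma open_local (X : topologicalType) (U : set X) :
  (forall x, U x -> exists V : set X, [/\ open V, V x & V `<=` U]) -> open U.
Proof.
move=> h; rewrite openE => x /h[V [oV Vx VU]].
by rewrite /interior nbhsE; exists V.
Qed.

Section Invertible.
Variable R : comPzRingType.
Implicit Types a b : R.

Lemma invertibleMl a b : invertible (a * b) -> invertible a.
Proof. by move=> [c abc]; exists (b * c); rewrite mulrA. Qed.

Lemma invertible_rmorph (R' : comPzRingType) (f : {rmorphism R -> R'}) a :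
  invertible a -> invertible (f a).
Proof. by move=> [b ab]; exists (f b); rewrite -rmorphM ab rmorph1. Qed.

End Invertible.

Section Sections.
Variable X : lrspace.
Implicit Types (U V : set X) (s t : forall x, stalk X x).

Lemma open_invertible U s : open U -> sections U s ->
  open [set x | U x /\ invertible (s x)].
Proof.
move=> oU sU; apply: open_local => x [Ux [b sb]].
have [V [t [oV Vx tV tb]]] := stalk_germ b.
have oUV : open (U `&` V) by exact: openI.
have stUV : sections (U `&` V) (fun y => s y * t y).
  apply: sectionsM => //; first by apply: (sections_restr _ _ _ sU) => // y [].
  by apply: (sections_restr _ _ _ tV) => // y [].
have [||W [oW Wx e]] := germ_eq oUV _ stUV (sections1 oUV) (x := x) => //.
  by rewrite tb sb.
exists (U `&` W); split; [exact: openI|by []|move=> y [Uy /e sty]].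
by split=> //; exists (t y).
Qed.

(** A quotient of sections is a section: near [x] it agrees with any section [r]
    that has the same germ at [x], as [r * t] and [s * t] have the same germ. *)
Lemma sections_div U s t : open U -> sections U t ->
  (forall x, U x -> invertible (t x)) -> sections U (fun x => s x * t x) ->
  sections U s.
Proof.
move=> oU tU tI stU; apply: sections_glue => // x Ux.
have [V [r [oV Vx rV rx]]] := stalk_germ (s x).
have oUV : open (U `&` V) by exact: openI.
have sub t' : sections U t' -> sections (U `&` V) t'.
  by move=> h; apply: (sections_restr _ _ _ h) => // y [].
have rUV : sections (U `&` V) r by apply: (sections_restr _ _ _ rV) => // y [].
have [||W [oW Wx e]] := germ_eq oUV _ (sectionsM oUV rUV (sub _ tU)) (sub _ stU) (x := x).
- by [].
- by rewrite rx.
have oW' : open (U `&` V `&` W) by exact: openI.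
exists (U `&` V `&` W); split=> //.
apply: (@sections_ext _ _ r) => //.
  by move=> y [[Uy Vy] Wy]; apply: (mulIinv (tI y Uy)); exact: e.
by apply: (sections_restr _ _ _ rUV) => // y [].
Qed.

End Sections.

(** * Morphisms to the spectrum of a ring *)

Section ToSpec.
Variables (R : comPzRingType) (Z : lrspace).

Lemma mor_glob (f : lrmor Z (Spec R)) a :
  sections setT (mor_pull f (glob a)).
Proof.
exact: (@mor_sections _ _ f setT _ openT (glob_sections a openT)).
Qed.

Lemma mor_prime (f : lrmor Z (Spec R)) a z :
  ~ f z a <-> invertible (mor_pull f (glob a) z).
Proof.
rewrite -glob_invertible; split; first exact: invertible_rmorph.
by move/mor_local.
Qed.

(** As the homomorphisms of stalks are local, the homomorphism from [R] to the
    global sections of [Z] tells which elements of [R] lie in the image of a point;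
    on fractions the homomorphisms of stalks are then determined. *)
Lemma toSpec_ext (f g : lrmor Z (Spec R)) :
  (forall a z, mor_pull f (glob a) z = mor_pull g (glob a) z) -> f = g.
Proof.
move=> fg.
have fgz z : f z = g z.
  apply: primespec_eq => a.
  have h : ~ f z a <-> ~ g z a by rewrite !mor_prime fg.
  by split=> za; apply: contrapT => /h.
apply: lrmor_ext => // s z.
have := fgz z; have := fg ^~ z; rewrite /mor_pull /pull.
move: (mor_stalk f z) (mor_stalk g z); move: (f z) (g z) => p q + + + pq.
subst q => u v e; have [a [t ->]] := locP (s p).
have tU : invertible (v (glob (val t) p)).
  by apply: invertible_rmorph; apply/glob_invertible; exact: (denomP t).
apply: (mulIinv tU); rewrite -{1}e -!rmorphM.
by rewrite mkfrac_glob e.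
Qed.

(** Conversely, let [r] be a homomorphism from [R] to global sections.  As stalks
    are local rings, the elements of [R] that are not invertible at [z] form a
    prime ideal, which is the image of [z]; the homomorphisms of stalks come from
    the universal property of localization. *)
Section Construction.
Variable r : forall z : Z, {rmorphism R -> stalk Z z}.
Hypothesis r_sections : forall a, sections setT (fun z => r z a).

Lemma adj_prime (z : Z) : is_prime_ideal [set a | ~ invertible (r z a)].
Proof.
have [n10 locZ] := stalk_local z.
split=> [|/= h|a b /= nab].
- split=> [[b]|a b|a b /= nb].
  + by rewrite rmorph0 mul0r => e; apply: n10.
  + by rewrite /= rmorphD; exact: locZ.
  + by rewrite rmorphM mulrC => /invertibleMl.
- by apply: h; rewrite rmorph1; exact: invertible1.
- apply: contrapT => /not_orP[/contrapT aI /contrapT bI]; apply: nab.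
  by rewrite rmorphM; exact: invertibleM.
Qed.

Definition adj_fun (z : Z) : Spec R := PrimeSpec (adj_prime z).

Lemma adj_inv (z : Z) a : prime_compl (adj_fun z) a -> invertible (r z a).
Proof. exact: contrapT. Qed.

Definition adj_stalk (z : Z) :
    {rmorphism stalk (Spec R) (adj_fun z) -> stalk Z z} :=
  loc_hom (@adj_inv z).

Lemma adj_stalk_glob (z : Z) a : adj_stalk z (glob a (adj_fun z)) = r z a.
Proof. exact: loc_hom_toloc. Qed.

Lemma adj_continuous : continuous adj_fun.
Proof.
apply/continuousP => _ [E ->]; apply: open_local => z.
move=> /existsNP[a /not_implyP[Ea /adj_inv ra]].
have := open_invertible openT (r_sections a).
set V := [set x | _] => oV; exists V; split=> // y [_ ray] h.
exact: (h a Ea).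
Qed.

Lemma adj_sections (V : set (Spec R)) s : open V -> sections V s ->
  sections (adj_fun @^-1` V) (pull adj_stalk s).
Proof.
move=> oV sV.
have oP (W : set (Spec R)) : open W -> open (adj_fun @^-1` W).
  by have /continuousP := adj_continuous; apply.
apply: sections_glue => [|z Vz]; first exact: oP.
have [a [g [h [ph hU hs]]]] := sections_basic oV sV Vz.
have oW := oP _ (@basic_open_open R h).
have rW a' : sections (adj_fun @^-1` (basic_open h)) (fun z => r z a').
  exact: (sections_restr openT _ _ (r_sections a')).
exists (adj_fun @^-1` (basic_open h)); split=> //.
apply: (sections_div oW (rW g)) => [y /hU[_ yg]|]; first exact: adj_inv.
apply: (@sections_ext _ _ (fun z => r z a)) => // y yh.
by rewrite -!adj_stalk_glob -(hs _ yh) rmorphM.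
Qed.

Lemma adj_local z : local_hom (adj_stalk z).
Proof.
move=> x; have [a [t ->]] := locP x => xI; rewrite -[mkfrac _ _]mulr1.
have /invertibleMl : invertible (mkfrac a t * glob (val t) (adj_fun z)).
  rewrite mkfrac_glob; apply/glob_invertible => za; apply: za.
  rewrite -adj_stalk_glob -(mkfrac_glob t) rmorphM; apply: invertibleM => //.
  by rewrite adj_stalk_glob; exact: adj_inv (denomP t).
by rewrite mulr1.
Qed.

Definition toSpec : lrmor Z (Spec R) := LRMor adj_continuous adj_sections adj_local.

Lemma toSpec_glob a z : mor_pull toSpec (glob a) z = r z a.
Proof. exact: adj_stalk_glob. Qed.

End Construction.
End ToSpec.

(** The homomorphism from [R] to the stalk at [z] that a morphism to [Spec R]
    induces. *)
Definition mor_hom (R : comPzRingType) (Z : lrspace) (f : lrmor Z (Spec R)) z :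
    {rmorphism R -> stalk Z z} :=
  mor_stalk f z \o toloc (prime_compl (f z)).

Lemma pull_Spec_map (R R' : comPzRingType) (h : {rmorphism R -> R'}) (Z : lrspace)
    (f : lrmor Z (Spec R')) a z :
  mor_pull (lrcomp (Spec_map h) f) (glob a) z = mor_pull f (glob (h a)) z.
Proof. by congr (mor_stalk f z _); exact: loc_hom_toloc. Qed.

Lemma Spec_map_glob (R R' : comPzRingType) (h : {rmorphism R -> R'}) a p :
  mor_pull (Spec_map h) (glob a) p = glob (h a) p.
Proof. exact: loc_hom_toloc. Qed.

Lemma Spec_map_comp (R R' R'' : comPzRingType) (h : {rmorphism R -> R'})
    (g : {rmorphism R' -> R''}) :
  lrcomp (Spec_map h) (Spec_map g) = Spec_map (g \o h).
Proof. by apply: toSpec_ext => a z; rewrite pull_Spec_map !Spec_map_glob. Qed.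

Lemma Spec_map_faithful (R R' : comPzRingType) (h g : {rmorphism R -> R'}) :
  Spec_map h = Spec_map g -> h =1 g.
Proof. by move=> e a; apply: glob_inj => p; rewrite -!Spec_map_glob e. Qed.

(** By [glob_surj] the global sections of [Spec R'] are the elements of [R']. *)
Lemma Spec_map_full (R R' : comPzRingType) (f : lrmor (Spec R') (Spec R)) :
  exists h : {rmorphism R -> R'}, f = Spec_map h.
Proof.
have fE a : exists b, forall p, mor_pull f (glob a) p = glob b p.
  exact: glob_surj (mor_glob f a).
pose h a := projT1 (cid (fE a)).
have hE a p : mor_hom f p a = glob (h a) p.
  by rewrite /h; case: cid => b /= e; exact: e.
have hB : zmod_morphism h.
  by move=> a b; apply: glob_inj => p; rewrite -hE rmorphB !hE /glob rmorphB.
have hM : monoid_morphism h.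
  split; first by apply: glob_inj => p; rewrite -hE rmorph1 /glob rmorph1.
  by move=> a b; apply: glob_inj => p; rewrite -hE rmorphM !hE /glob rmorphM.
pose hR : {rmorphism R -> R'} := HB.pack h
  (GRing.isZmodMorphism.Build R R' h hB) (GRing.isMonoidMorphism.Build R R' h hM).
exists hR; apply: toSpec_ext => a p; rewrite Spec_map_glob; exact: hE.
Qed.

(** * Open subspaces and charts *)

Lemma mor_pull_comp (X Y Z : lrspace) (g : lrmor Y Z) (f : lrmor X Y) s x :
  mor_pull (lrcomp g f) s x = mor_pull f (mor_pull g s) x.
Proof. by []. Qed.

Section OpenSubspaces.
Variables (X : lrspace) (U : set X) (oU : open U).

Lemma open_incl_mem (w : open_subspace oU) : U (open_incl oU w).
Proof. exact: set_valP. Qed.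

(** A morphism to an open subspace is a morphism to the whole space with values in
    the open set: [open_incl_mono] gives uniqueness, [open_fact] existence. *)
Lemma open_incl_mono (Z : lrspace) (f g : lrmor Z (open_subspace oU)) :
  lrcomp (open_incl oU) f = lrcomp (open_incl oU) g -> f = g.
Proof.
move=> e; have fg z : f z = g z.
  by apply: val_inj; rewrite -[LHS]/(lrcomp (open_incl oU) f z) e.
apply: lrmor_ext => // s z.
(* Only the value of s at f z matters, so s can be taken to come from X. *)
pose t : forall x, stalk X x := sub_extend s.
have st : s = mor_pull (open_incl oU) t.
  apply: functional_extensionality_dep => w.
  by rewrite /t -[RHS]/(sub_extend s (val w)) sub_extendE.
by rewrite st -!mor_pull_comp e.
Qed.

Section Factor.
Variables (Z : lrspace) (f : lrmor Z X).
Hypothesis fU : forall z, U (f z).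

Let fact_fun (z : Z) : open_subspace oU := exist _ (f z) (mem_set (fU z)).

Let fact_stalk z :
    {rmorphism stalk (open_subspace oU) (fact_fun z) -> stalk Z z} :=
  mor_stalk f z.

Let fact_continuous : continuous fact_fun.
Proof. by apply/continuousP => _ [W oW <-]; exact: (preimage_open f oW). Qed.

Let fact_sections (V : set (open_subspace oU)) s : open V -> sections V s ->
  sections (fact_fun @^-1` V) (pull fact_stalk s).
Proof.
move=> oV [t tV st].
have e : f @^-1` (val @` V) = fact_fun @^-1` V.
  apply/seteqP; split=> z /=; last by exists (fact_fun z).
  by move=> [w Vw wz]; have -> : fact_fun z = w by exact: val_inj.
have oV' := open_sub_image oU oV.
rewrite -e; apply: (@sections_ext _ _ (mor_pull f t)).
- exact: preimage_open.
- move=> z; rewrite e => Vz; apply: esym; rewrite /pull st //.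
- exact: mor_sections.
Qed.

Definition open_fact : lrmor Z (open_subspace oU) :=
  LRMor fact_continuous fact_sections (@mor_local _ _ f).

Lemma open_factK : lrcomp (open_incl oU) open_fact = f.
Proof. exact: lrmor_ext. Qed.

End Factor.
End OpenSubspaces.

(** [chart j U] says that [j] is an open immersion with image [U].  This form
    involves no inverse on the source and avoids comparing the stalks of [Y] and
    of [X] at points that are only propositionally equal. *)
Definition chart (Y X : lrspace) (j : lrmor Y X) (U : set X) : Prop :=
  [/\ forall y, U (j y),
      forall (Z : lrspace) (f g : lrmor Z Y), lrcomp j f = lrcomp j g -> f = g &
      exists (oU : open U) (k : lrmor (open_subspace oU) Y),
        lrcomp j k = open_incl oU].

Section Charts.
Variables (Y X : lrspace) (j : lrmor Y X) (U : set X).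
Hypothesis jU : chart j U.

Lemma chart_open : open U.
Proof. by have [_ _ []] := jU. Qed.

Lemma chart_inv (oU : open U) : exists (k : lrmor (open_subspace oU) Y)
    (j' : lrmor Y (open_subspace oU)),
  [/\ lrcomp j k = open_incl oU, lrcomp (open_incl oU) j' = j,
      lrcomp k j' = lrid Y & lrcomp j' k = lrid _].
Proof.
have [jY jm [oU' [k jk]]] := jU.
have e : oU' = oU by exact: Prop_irrelevance.
subst oU'; exists k, (open_fact oU jY).
have j'E := open_factK oU jY; split=> //.
  by apply: jm; rewrite lrcompf1 lrcompA jk.
by apply: open_incl_mono; rewrite lrcompf1 lrcompA j'E.
Qed.

Lemma chart_imageE (oU : open U) (k : lrmor (open_subspace oU) Y)
    (j' : lrmor Y (open_subspace oU)) (O : set Y) :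
  lrcomp j k = open_incl oU -> lrcomp (open_incl oU) j' = j ->
  lrcomp k j' = lrid Y -> j @` O = val @` (k @^-1` O).
Proof.
move=> jk ij' kj'; apply/seteqP; split=> x /= [w Ow <-].
  exists (j' w); first by rewrite -[k _]/(lrcomp k j' w) kj'.
  by rewrite -[LHS]/(lrcomp (open_incl oU) j' w) ij'.
by exists (k w) => //; rewrite -[LHS]/(lrcomp j k w) jk.
Qed.

Lemma chart_surj x : U x -> exists y, j y = x.
Proof.
move=> Ux; have [k [j' [jk _ _ _]]] := chart_inv chart_open.
exists (k (exist _ x (mem_set Ux))).
by rewrite -[LHS]/(lrcomp j k _) jk.
Qed.

Lemma chart_inj : injective j.
Proof.
have [k [j' [jk ij' kj' _]]] := chart_inv chart_open.
move=> y z; rewrite -{1 2}ij' => /val_inj /(congr1 k).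
by rewrite -![k _]/(lrcomp k j' _) kj'.
Qed.

Lemma chart_image (O : set Y) : open O -> open (j @` O).
Proof.
have [k [j' [jk ij' kj' _]]] := chart_inv chart_open.
move=> oO; rewrite (chart_imageE _ jk ij' kj').
by apply: open_sub_image; [exact: chart_open|exact: (preimage_open k oO)].
Qed.

Lemma chart_sections (O : set Y) t : open O -> sections O t ->
  exists2 s, sections (j @` O) s & forall y, mor_pull j s y = t y.
Proof.
have [k [j' [jk ij' kj' _]]] := chart_inv chart_open.
move=> oO tO; have oK := preimage_open k oO.
have ks : sections (k @^-1` O) (mor_pull k t) by exact: mor_sections.
exists (sub_extend (mor_pull k t)).
  rewrite (chart_imageE _ jk ij' kj').
  by apply/sub_sectionsE => //; exact: chart_open.
move=> y; rewrite -ij' mor_pull_comp.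
have -> : mor_pull (open_incl chart_open) (sub_extend (mor_pull k t)) = mor_pull k t.
  apply: functional_extensionality_dep => w.
  by rewrite -[RHS](sub_extendE (U := U)).
by rewrite -mor_pull_comp kj'.
Qed.

(** The homomorphisms of stalks are injective.  The quantifier over [y], which is
    unique, spares the transport of [s x] along [j y = x]. *)
Lemma chart_stalk s t x : U x ->
  (forall y, j y = x -> mor_pull j s y = mor_pull j t y) -> s x = t x.
Proof.
have [k [j' [jk _ _ _]]] := chart_inv chart_open.
move=> Ux h; pose w : open_subspace chart_open := exist _ x (mem_set Ux).
rewrite -[s x]/(mor_pull (open_incl chart_open) s w).
rewrite -[t x]/(mor_pull (open_incl chart_open) t w) -jk !mor_pull_comp.
rewrite {1}/mor_pull {1}/pull h //.
by rewrite -[LHS]/(lrcomp j k w) jk.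
Qed.

End Charts.

Lemma chart_comp (Z Y X : lrspace) (i : lrmor Z Y) (j : lrmor Y X) O U :
  chart i O -> chart j U -> chart (lrcomp j i) (j @` O).
Proof.
move=> iO jU; have oO := chart_open iO; have oU := chart_open jU.
have oJ := chart_image jU oO.
have [k [j' [jk ij' _ j'k]]] := chart_inv jU oU.
have [l [i' [il _ _ _]]] := chart_inv iO oO.
split.
- by move=> z; exists (i z) => //; have [] := iO.
- move=> W f g; rewrite -!lrcompA.
  by have [_ jm _] := jU; have [_ im _] := iO => /jm /im.
have JU (w : open_subspace oJ) : U (open_incl oJ w).
  by have [y _ <-] := open_incl_mem w; have [] := jU.
pose a := open_fact oU JU.
have kaO w : O (lrcomp k a w).
  have [y Oy e] := open_incl_mem w.
  rewrite (_ : lrcomp k a w = y) //; apply: (chart_inj jU); rewrite e.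
  by rewrite -[LHS]/(lrcomp (lrcomp j k) a w) jk open_factK.
exists oJ, (lrcomp l (open_fact oO kaO)).
by rewrite -lrcompA [lrcomp i _]lrcompA il open_factK lrcompA jk open_factK.
Qed.

Lemma chart_sub (Y X : lrspace) (j : lrmor Y X) O U (oU : open U) :
  chart j O -> O `<=` U ->
  exists2 g : lrmor Y (open_subspace oU), lrcomp (open_incl oU) g = j &
    chart g (open_incl oU @^-1` O).
Proof.
move=> jO OU; have oO := chart_open jO.
have jU y : U (j y) by apply: OU; have [] := jO.
exists (open_fact oU jU); first exact: open_factK.
split; first by have [] := jO.
- move=> Z f g /(congr1 (lrcomp (open_incl oU))); rewrite !lrcompA open_factK.
  by have [_ + _] := jO; apply.
have oP := preimage_open (open_incl oU) oO.
have [k [j' [jk _ _ _]]] := chart_inv jO oO.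
pose f := lrcomp (open_incl oU) (open_incl oP).
have fO w : O (f w) := open_incl_mem w.
exists oP, (lrcomp k (open_fact oO fO)); apply: open_incl_mono.
by rewrite !lrcompA open_factK jk open_factK.
Qed.

Lemma chart_iso (Y X : lrspace) (U : set X) (oU : open U)
    (f : lrmor (open_subspace oU) Y) (g : lrmor Y (open_subspace oU)) :
  lrcomp g f = lrid _ -> lrcomp f g = lrid _ -> chart (lrcomp (open_incl oU) g) U.
Proof.
move=> gf fg; split; first by move=> y; exact: open_incl_mem.
  move=> Z a b; rewrite -!lrcompA => /open_incl_mono /(congr1 (lrcomp f)).
  by rewrite !lrcompA fg !lrcomp1f.
by exists oU, f; rewrite -lrcompA gf lrcompf1.
Qed.

(** * Schemes *)

Lemma scheme_chart (X : lrspace) : is_scheme X <->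
  forall x : X, exists (R : comPzRingType) (j : lrmor (Spec R) X) (U : set X),
    chart j U /\ U x.
Proof.
split=> [h x|h x].
  have [U [oU [Ux [R [f [g [gf fg]]]]]]] := h x.
  by exists R, (lrcomp (open_incl oU) g), U; split=> //; exact: (chart_iso gf fg).
have [R [j [U [jU Ux]]]] := h x.
exists U, (chart_open jU); split=> //; exists R.
by have [k [j' [_ _ kj' j'k]]] := chart_inv jU (chart_open jU); exists k, j'.
Qed.

Definition powers (R : comPzRingType) (h : R) : mulset R.
Proof.
exists (fun a => exists n, a = h ^+ n); first by exists 0%N; rewrite expr0.
by move=> _ _ [n ->] [m ->]; exists (n + m)%N; rewrite exprD.
Defined.

(** [D(h)] is the spectrum of [R_h]: its inclusion lifts to [Spec R_h] because [h]
    is invertible in the stalks over [D(h)]. *)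
Lemma basic_chart (R : comPzRingType) (h : R) :
  chart (Spec_map (toloc (powers h))) (basic_open h).
Proof.
have hU : invertible (toloc (powers h) h).
  by apply: toloc_invertible; exists 1%N; rewrite expr1.
split.
- move=> p; apply: (glob_invertible p (toloc (powers h) h)).1.
  exact: invertible_rmorph.
- move=> Z f g fg; apply: toSpec_ext => x z.
  have fgl a : mor_pull f (glob (toloc (powers h) a)) z =
               mor_pull g (glob (toloc (powers h) a)) z.
    by rewrite -!pull_Spec_map fg.
  have [a [s ->]] := locP x.
  have sU : invertible (toloc (powers h) (val s)).
    by apply: toloc_invertible; exact: denomP.
  have fU : invertible (mor_hom g z (toloc (powers h) (val s))).
    exact: invertible_rmorph.
  apply: (mulIinv fU); rewrite -{1}[mor_hom g _ _]fgl.
  rewrite -[LHS](rmorphM (mor_hom f z)) -[RHS](rmorphM (mor_hom g z)).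
  by rewrite toloc_mkfrac; exact: fgl.
have oU : @open (Spec R) (basic_open h) := basic_open_open h; exists oU.
pose X := open_subspace oU.
have sU (p : X) s : powers h s -> invertible (mor_hom (open_incl oU) p s).
  move=> [n ->]; apply: (invertible_rmorph (mor_stalk (open_incl oU) p)).
  apply: (glob_invertible (open_incl oU p) _).2 => /prime_exp.
  exact: (set_valP p).
pose r (p : X) := loc_hom (@sU p).
have rE p a : r p (toloc _ a) = mor_hom (open_incl oU) p a by exact: loc_hom_toloc.
have [k kE] : exists k : lrmor X (Spec (loc (powers h))),
    forall x p, mor_pull k (glob x) p = r p x.
  have rS x : sections setT (fun p => r p x).
    have [a [s ->]] := locP x.
    apply: (sections_div openT (mor_glob (open_incl oU) (val s))).
      by move=> p _; exact: (sU p _ (denomP s)).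
    apply: (sections_ext openT _ (mor_glob (open_incl oU) a)) => p _.
    rewrite -[LHS]/(mor_hom (open_incl oU) p a).
    by rewrite -[RHS]/(_ * mor_hom (open_incl oU) p _) -!rE -rmorphM toloc_mkfrac.
  by exists (toSpec rS); exact: toSpec_glob.
by exists k; apply: toSpec_ext => a p; rewrite pull_Spec_map kE rE.
Qed.

(** The opens [D(h)] form a basis of the topology of [Spec R], and they are
    affine. *)
Lemma open_subscheme (X : lrspace) (U : set X) (oU : open U) :
  is_scheme X -> is_scheme (open_subspace oU).
Proof.
move=> /scheme_chart hX; apply/scheme_chart => w.
have [R [j [V [jV Vw]]]] := hX (open_incl oU w).
have [p pw] := chart_surj jV Vw.
have [|h ph hU] := basic_open_basis (preimage_open j oU) (p := p).
  by rewrite /= pw; exact: open_incl_mem.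
have [|g _ gO] := chart_sub oU (chart_comp (basic_chart h) jV).
  by move=> _ [q qh <-]; exact: hU.
exists (loc (powers h)), g, (open_incl oU @^-1` (j @` basic_open h)).
by split=> //; exists p.
Qed.

(** * Fibre products over affine opens *)

(** [D] is the tensor product of [R'] and [C] over [A].  Uniqueness of the
    induced homomorphisms is replaced by the stronger condition that the images
    of [R'] and [C] generate [D] as a ring: it is also what makes the family of
    homomorphisms induced on the stalks of a space take values in sections.
    Stalks are local rings, hence the restriction to nonzero targets. *)
Definition is_pushout (A R' C D : comPzRingType) (a : {rmorphism A -> R'})
    (b : {rmorphism A -> C}) (i : {rmorphism R' -> D}) (k : {rmorphism C -> D}) :
    Prop :=
  [/\ forall x, i (a x) = k (b x),
      forall Q : D -> Prop, Q 1 ->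
        (forall d d', Q d -> Q d' -> Q (d - d')) ->
        (forall d d', Q d -> Q d' -> Q (d * d')) ->
        (forall x, Q (i x)) -> (forall c, Q (k c)) -> forall d, Q d &
      forall (E : comPzRingType) (g : {rmorphism R' -> E}) (h : {rmorphism C -> E}),
        1 <> 0 :> E -> (forall x, g (a x) = h (b x)) ->
        exists l : {rmorphism D -> E},
          (forall x, l (i x) = g x) /\ (forall c, l (k c) = h c)].

Section Pushout.
Variables (A R' C D : comPzRingType) (a : {rmorphism A -> R'}).
Variables (b : {rmorphism A -> C}) (i : {rmorphism R' -> D}) (k : {rmorphism C -> D}).
Hypothesis po : is_pushout a b i k.

Lemma pushout_comm : lrcomp (Spec_map a) (Spec_map i) = lrcomp (Spec_map b) (Spec_map k).
Proof.
apply: toSpec_ext => x p; rewrite !pull_Spec_map !Spec_map_glob.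
by have [-> _ _] := po.
Qed.

Lemma pushout_mono (Z : lrspace) (f g : lrmor Z (Spec D)) :
  lrcomp (Spec_map i) f = lrcomp (Spec_map i) g ->
  lrcomp (Spec_map k) f = lrcomp (Spec_map k) g -> f = g.
Proof.
move=> ei ek; apply: toSpec_ext => + z; have [_ gen _] := po; apply: gen.
- by rewrite -[LHS]/(mor_hom f z 1) -[RHS]/(mor_hom g z 1) !rmorph1.
- move=> d d' e e'; rewrite -[LHS]/(mor_hom f z _) -[RHS]/(mor_hom g z _) !rmorphB.
  by congr (_ - _).
- move=> d d' e e'; rewrite -[LHS]/(mor_hom f z _) -[RHS]/(mor_hom g z _) !rmorphM.
  by congr (_ * _).
- by move=> x; rewrite -!pull_Spec_map ei.
- by move=> c; rewrite -!pull_Spec_map ek.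
Qed.

(** The universal property of [D] is applied in each stalk.  So [Spec D] is a fibre
    product among all locally ringed spaces, with [pushout_mono] for uniqueness. *)
Lemma pushout_lift (Z : lrspace) (f : lrmor Z (Spec R')) (g : lrmor Z (Spec C)) :
  lrcomp (Spec_map a) f = lrcomp (Spec_map b) g ->
  exists h : lrmor Z (Spec D),
    lrcomp (Spec_map i) h = f /\ lrcomp (Spec_map k) h = g.
Proof.
move=> fg; have [_ gen lift] := po.
have hl (z : Z) : exists l : {rmorphism D -> stalk Z z},
    (forall x, l (i x) = mor_hom f z x) /\ (forall c, l (k c) = mor_hom g z c).
  apply: lift; first by have [] := stalk_local z.
  move=> x; rewrite -[LHS]/(mor_pull f (glob (a x)) z).
  by rewrite -[RHS]/(mor_pull g (glob (b x)) z) -!pull_Spec_map fg.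
pose l z := projT1 (cid (hl z)).
have li z x : l z (i x) = mor_hom f z x by rewrite /l; case: cid => ? [].
have lk z c : l z (k c) = mor_hom g z c by rewrite /l; case: cid => ? [].
have lS d : sections setT (fun z => l z d).
  move: d; apply: gen => [|d d' s s'|d d' s s'|x|c].
  - apply: (sections_ext openT _ (sections1 openT)) => z _.
    by rewrite rmorph1.
  - apply: (sections_ext openT _ (sectionsB openT s s')) => z _.
    by rewrite rmorphB.
  - apply: (sections_ext openT _ (sectionsM openT s s')) => z _.
    by rewrite rmorphM.
  - by apply: (sections_ext openT _ (mor_glob f x)) => z _; rewrite li.
  - by apply: (sections_ext openT _ (mor_glob g c)) => z _; rewrite lk.
exists (toSpec lS).
split; apply: toSpec_ext => x z; rewrite pull_Spec_map toSpec_glob.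
  exact: li.
exact: lk.
Qed.

(** The universal property of [P] gives [Spec D -> P], and [pushout_lift] a
    morphism back from the part of [P] above [U].  They are inverse to each other
    by uniqueness in the universal property of [P], which applies to this part as
    it is a scheme. *)
Lemma fibre_chart (T : lrspace) (tau : lrmor T (Spec A))
    (P : fibre_product (Spec_map a) tau) (j : lrmor (Spec C) T) (U : set T) :
  chart j U -> lrcomp tau j = Spec_map b ->
  exists u : lrmor (Spec D) P,
    [/\ lrcomp (fp1 P) u = Spec_map i, lrcomp (fp2 P) u = lrcomp j (Spec_map k) &
        chart u (fp2 P @^-1` U)].
Proof.
move=> jU jtau; have [jU1 jm _] := jU.
have oU := chart_open jU; have [l [j' [jl _ _ _]]] := chart_inv jU oU.
have [|u [[u1 u2] _]] := fp_univ P (a := Spec_map i) (b := lrcomp j (Spec_map k))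
  (@Spec_is_scheme D).
  by rewrite lrcompA jtau pushout_comm.
exists u; split=> //; split.
- move=> p; rewrite /preimage /= -[fp2 P (u p)]/(lrcomp (fp2 P) u p) u2.
  exact: jU1.
- move=> Z f g fg; apply: pushout_mono; first by rewrite -u1 -!lrcompA fg.
  by apply: jm; rewrite !lrcompA -u2 -!lrcompA fg.
have oW : open (fp2 P @^-1` U) := preimage_open (fp2 P) oU.
exists oW; pose inc := open_incl oW.
have incU (w : open_subspace oW) : U (lrcomp (fp2 P) inc w) := open_incl_mem w.
pose q := lrcomp l (open_fact oU incU).
have jq : lrcomp j q = lrcomp (fp2 P) inc by rewrite lrcompA jl open_factK.
have [|v [vi vk]] := pushout_lift (f := lrcomp (fp1 P) inc) (g := q).
  by rewrite -jtau -lrcompA jq !lrcompA fp_comm.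
exists v.
have [|w [_ wU]] := fp_univ P (a := lrcomp (fp1 P) inc) (b := lrcomp (fp2 P) inc)
  (open_subscheme (oU := oW) (@fp_scheme _ _ _ _ _ P)).
  by rewrite !lrcompA fp_comm.
transitivity w; last exact: wU.
apply: esym; apply: wU; rewrite !lrcompA u1 u2 vi.
by rewrite -lrcompA vk jq.
Qed.

End Pushout.

(** * Closed immersions *)

Section ClosedImmersion.
Variables (X Y : lrspace) (f : lrmor X Y).

Definition affine_over (W : set Y) (P D : comPzRingType) (psi : {rmorphism P -> D})
    (v : lrmor (Spec P) Y) (u : lrmor (Spec D) X) : Prop :=
  [/\ chart v W, chart u (f @^-1` W) & lrcomp f u = lrcomp v (Spec_map psi)].

Lemma affine_overP W (P D : comPzRingType) (psi : {rmorphism P -> D}) v u x :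
  affine_over W psi v u -> W (f x) ->
  exists p, u p = x /\ f x = v (Spec_map psi p).
Proof.
move=> [vW uW e] Wfx; have [p px] := chart_surj uW Wfx.
by exists p; split=> //; rewrite -px -[LHS]/(lrcomp f u p) e.
Qed.

(** For [d] in [D], the elements [a] of [P] such that [psi a * d] is in the image
    of [psi] form an ideal.  Around each point of [Spec P] the section [d] is the
    image of a fraction, so this ideal is contained in no prime. *)
Lemma closed_immersion_surj W (P D : comPzRingType) (psi : {rmorphism P -> D}) v u :
  closed_immersion f -> affine_over W psi v u -> forall d, exists a, d = psi a.
Proof.
move=> [_ _ _ surj] [vW uW e] d.
suff [a] : [set a | exists a', psi a * d = psi a'] 1.
  by rewrite rmorph1 mul1r => ->; exists a.
apply: ideal1 => [|y].
  split; first by exists 0; rewrite rmorph0 mul0r.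
    by move=> a b [a' ea] [b' eb]; exists (a' + b'); rewrite !rmorphD mulrDl ea eb.
  by move=> r a [a' ea]; exists (r * a'); rewrite !rmorphM -mulrA ea.
have [s sS sE] := chart_sections uW openT (glob_sections d openT).
have uT : u @` setT = f @^-1` W.
  apply/seteqP; split=> x /=; first by move=> [p _ <-]; have [uW1 _ _] := uW; exact: uW1.
  by move=> /(chart_surj uW)[p]; exists p.
rewrite uT in sS.
have Wvy : W (v y) by have [] := vW.
have [W' [t [oW' W'y W'W tW' tE]]] := surj W s (chart_open vW) sS _ Wvy.
have oV := preimage_open v oW'.
have vt : sections (v @^-1` W') (mor_pull v t) by exact: mor_sections.
have [a [g [h [yh hV hE]]]] := sections_basic oV vt W'y.
have [|n hn] := @stalks_eq _ (psi h) (psi g * d) (psi a).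
  move=> p ph; pose q := Spec_map psi p; have [W'q _] := hV q ph.
  have fup : f (u p) = v q by rewrite -[LHS]/(lrcomp f u p) e.
  have : mor_pull (Spec_map psi) (mor_pull v t) p * glob (psi g) p = glob (psi a) p.
    rewrite -!Spec_map_glob /mor_pull /pull -rmorphM.
    by rewrite -[RHS]/(mor_stalk _ _ _) -(hE q ph).
  rewrite -mor_pull_comp -e mor_pull_comp -[mor_pull u _ p]/(mor_stalk u p _).
  rewrite tE; last by rewrite fup.
  rewrite -[mor_stalk u p _]/(mor_pull u s p) sE => ae.
  by rewrite -[RHS]ae /glob -rmorphM mulrC.
exists (h ^+ n * g); last first.
  by case/primeM => [/prime_exp //|yg]; have [_] := hV y yh.
by exists (h ^+ n * a); rewrite !rmorphM rmorphXn -mulrA hn.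
Qed.

Hypothesis local_psi : forall y, exists W (P D : comPzRingType) (psi : {rmorphism P -> D}) v u,
  [/\ W y, affine_over W psi v u & forall d, exists a, d = psi a].

Let loc_f x : exists W (P D : comPzRingType) (psi : {rmorphism P -> D}) v u p,
  [/\ affine_over W psi v u, forall d, exists a, d = psi a, u p = x &
      f x = v (Spec_map psi p)].
Proof.
have [W [P [D [psi [v [u [Wy sq surj]]]]]]] := local_psi (f x).
have [p [up e]] := affine_overP sq Wy.
by exists W, P, D, psi, v, u, p.
Qed.

Let surj_inj (P D : comPzRingType) (psi : {rmorphism P -> D}) p q :
  (forall d, exists a, d = psi a) -> Spec_map psi p = Spec_map psi q -> p = q.
Proof.
move=> surj e; apply: primespec_eq => d; have [a ->] := surj d.
by rewrite -[p (psi a)]/(prime_set (Spec_map psi p) a) e.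
Qed.

Let local_injective : injective f.
Proof.
move=> x x' e; have [W [P [D [psi [v [u [Wy sq surj]]]]]]] := local_psi (f x).
have [p [px xp]] := affine_overP sq Wy.
have [|p' [px' xp']] := affine_overP (x := x') sq; first by rewrite -e.
have [vW _ _] := sq; rewrite -px -px'; congr (u _); apply: (surj_inj surj).
by apply: (chart_inj vW); rewrite -xp -xp' e.
Qed.

Let local_embedding (U : set X) : open U -> exists2 V : set Y, open V & U = f @^-1` V.
Proof.
move=> oU; exists (\bigcup_(V in [set V | open V /\ f @^-1` V `<=` U]) V).
  by apply: bigcup_open => V [].
apply/seteqP; split=> [x Ux|x [V [_ VU] Vfx]]; last exact: VU.
have [W [P [D [psi [v [u [p [sq surj px xp]]]]]]]] := loc_f x.
have [vW uW e] := sq.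
have [|b pb bU] := basic_open_basis (preimage_open u oU) (p := p).
  by rewrite /= px.
have [a ba] := surj b; subst b.
exists (v @` basic_open a); last by rewrite xp; exists (Spec_map psi p).
split; first exact: (chart_image vW (basic_open_open a)).
move=> x' [q qa vq].
have [|p' [px' xp']] := affine_overP (x := x') sq.
  by rewrite -vq; have [] := vW.
rewrite -px'; apply: bU; rewrite -[p' (psi a)]/(prime_set (Spec_map psi p') a).
by rewrite (_ : Spec_map psi p' = q) //; apply: (chart_inj vW); rewrite -xp' vq.
Qed.

(** A prime that contains the kernel of the surjection [psi] has a prime image, and
    is the preimage of this image. *)
Let surj_range (P D : comPzRingType) (psi : {rmorphism P -> D}) (q : Spec P) :
  (forall d, exists a, d = psi a) -> ~ range (Spec_map psi) q ->
  exists2 a, psi a = 0 & ~ q a.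
Proof.
move=> surj nq; apply: contrapT => no; apply: nq.
have ker a : psi a = 0 -> q a.
  by move=> a0; apply: contrapT => qa; apply: no; exists a.
have kerE a b : psi a = psi b -> q a -> q b.
  move=> ab qa; rewrite -[b](subrK a); apply: primeD => //.
  by apply: ker; rewrite rmorphB ab subrr.
have prq : is_prime_ideal [set d | exists2 a, q a & d = psi a].
  split=> [|[a qa a1]|d d'].
  - split=> [|_ _ [a qa ->] [b qb ->]|d _ [a qa ->]].
    + by exists 0; rewrite ?rmorph0 //; exact: prime0.
    + by exists (a + b); rewrite ?rmorphD //; exact: primeD.
    + have [c ->] := surj d.
      by exists (c * a); rewrite ?rmorphM //; exact: primeMr.
  - by apply: (@prime1 _ q); apply: (kerE a) => //; rewrite rmorph1.
  have [a ->] := surj d; have [b ->] := surj d' => -[c qc]; rewrite -rmorphM.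
  move=> /esym /kerE /(_ qc) /primeM[qa|qb]; first by left; exists a.
  by right; exists b.
exists (PrimeSpec prq) => //; apply: primespec_eq => a /=.
split=> [[b qb /esym /kerE]|qa]; first exact.
by exists a.
Qed.

Let local_closed : open (~` range f).
Proof.
apply: open_local => y ny.
have [W [P [D [psi [v [u [Wy sq surj]]]]]]] := local_psi y; have [vW uW e] := sq.
have [q qy] := chart_surj vW Wy.
have [[p _ pq]|a a0 qa] := @surj_range _ _ psi q surj.
  by apply: ny; exists (u p) => //; rewrite -[LHS]/(lrcomp f u p) e -qy -pq.
exists (v @` basic_open a); split; first exact: (chart_image vW (basic_open_open a)).
  by exists q.
move=> _ [r ra <-] [x _ xr].
have [|p [_ xp]] := affine_overP (x := x) sq.
  by rewrite xr; have [] := vW.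
apply: ra; rewrite -(chart_inj vW (etrans (esym xp) xr)).
by rewrite /= a0; exact: prime0.
Qed.

(** Outside the closed image of [f] there is nothing to lift.  At a point of the
    image the section is a fraction over [Spec D], whose numerator and denominator
    lift along [psi]. *)
Let local_surj (V : set Y) s : open V -> sections (f @^-1` V) s ->
  forall y, V y -> exists (W : set Y) t,
    [/\ open W, W y, W `<=` V, sections W t &
        forall x, W (f x) -> mor_pull f t x = s x].
Proof.
move=> oV sV y Vy.
have [[x _ xy]|ny] := pselect (range f y); last first.
  have oW : open (V `&` ~` range f) by exact: openI.
  exists (V `&` ~` range f), (fun=> 1).
  split=> //; first exact: sections1.
  by move=> x [_ nx]; case: nx; exists x.
subst y; have [W [P [D [psi [v [u [p [sq surj px xp]]]]]]]] := loc_f x.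
have [vW uW e] := sq.
have oU := preimage_open u (preimage_open f oV).
have us : sections (u @^-1` (f @^-1` V)) (mor_pull u s).
  exact: (@mor_sections _ _ u _ s (preimage_open f oV) sV).
have [|b [g [h [ph hU hs]]]] := sections_basic oU us (p := p); first by rewrite /= px.
have [[b' bE] [g' gE] [h' hE]] := And3 (surj b) (surj g) (surj h); subst b g h.
have oO : @open (Spec P) (basic_open (g' * h')) := basic_open_open _.
pose t0 (q : Spec P) : stalk (Spec P) q := glob b' q * inverse (glob g' q).
have t0E (q : Spec P) : ~ q (g' * h') -> t0 q * glob g' q = glob b' q.
  move=> qgh; rewrite /t0 -mulrA [inverse _ * _]mulrC inverseP ?mulr1 //.
  by apply/glob_invertible => qg; apply: qgh; rewrite mulrC; exact: primeMr.
have tS : sections (basic_open (g' * h') : set (Spec P)) t0.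
  apply: (sections_div oO (glob_sections g' oO)) => [q qgh|].
    by apply/glob_invertible => qg; apply: qgh; rewrite mulrC; exact: primeMr.
  apply: (sections_ext oO _ (glob_sections b' oO)) => q qgh.
  by rewrite t0E.
have [t tS' tE] := chart_sections vW oO tS.
have oW := chart_image vW oO; have oWV := openI oV oW.
exists (V `&` v @` basic_open (g' * h')), t; split=> //.
- split=> //=; rewrite xp; exists (Spec_map psi p) => //.
  rewrite /basic_open /= rmorphM => /primeM[]; last by [].
  by have [] := hU p ph.
- by apply: (sections_restr oW oWV _ tS') => ? [].
move=> x' [Vx' [q qgh vq]].
have Wx' : W (f x') by rewrite -vq; have [] := vW.
apply: (chart_stalk uW) => [|p' px']; first exact: Wx'.
have qE : Spec_map psi p' = q.
  by apply: (chart_inj vW); rewrite vq -px' -[RHS]/(lrcomp f u p') e.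
subst q.
have ph' : ~ p' (psi h') by move=> k; apply: qgh; exact: primeMr.
have gU : invertible (glob (psi g') p') by apply/glob_invertible; have [] := hU p' ph'.
apply: (mulIinv gU); rewrite (hs p' ph') -mor_pull_comp e mor_pull_comp.
rewrite -!Spec_map_glob.
rewrite -[RHS]/(mor_stalk (Spec_map psi) p' (glob b' (Spec_map psi p'))).
rewrite -(t0E _ qgh) rmorphM; congr (_ * _).
by congr (mor_stalk _ _ _); exact: tE.
Qed.

Lemma closed_immersion_local : closed_immersion f.
Proof.
split; [exact: local_injective|exact: local_embedding| |exact: local_surj].
by rewrite -openC; exact: local_closed.
Qed.

End ClosedImmersion.

(** * Polynomial rings as tensor products *)

(** Lets polynomials have their coefficients in a stalk, which is nonzero as it is
    local. *)
Lemma comNz_of (E : comPzRingType) : 1 <> 0 :> E ->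
  exists N : comNzRingType, E = N :> comPzRingType.
Proof.
move=> /eqP h.
pose N : comNzRingType := HB.pack (GRing.ComPzRing.sort E)
  (GRing.ComPzRing.class E) (GRing.PzSemiRing_isNonZero.Build E h).
by exists N; case: E h @N.
Qed.

Lemma poly_pushout (A C : comNzRingType) (b : {rmorphism A -> C}) :
  is_pushout (@polyC A) b (map_poly b) (@polyC C).
Proof.
split=> [x|Q Q1 QB QM Qi Qk|E g h E10 gh]; first exact: map_polyC.
  have QD x y : Q x -> Q y -> Q (x + y).
    move=> Qx Qy; rewrite -[y]opprK -[- y]sub0r; apply: (QB) => //.
    by apply: (QB) => //; rewrite -(subrr 1); exact: QB.
  elim/poly_ind => [|p c Qp]; first by rewrite -(subrr 1); exact: QB.
  apply: QD; last exact: Qk.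
  by apply: QM => //; rewrite -(map_polyX b); exact: Qi.
have [N EN] := comNz_of E10; subst E.
pose l : {rmorphism {poly C} -> N} := horner_morph (fun c => mulrC (g 'X) (h c)).
exists l; split=> [|c]; last exact: horner_morphC.
elim/poly_ind => [|p a IHp]; first by rewrite !rmorph0.
rewrite !rmorphD !rmorphM /= IHp map_polyX map_polyC.
rewrite -[l 'X]/(horner_morph _ 'X) horner_morphX.
by rewrite -[l _%:P]/(horner_morph _ _%:P) horner_morphC gh.
Qed.

(** * Base change of a free algebra *)

Section BaseChange.
Variables (A : comNzRingType) (B : comAlgType A) (n : nat) (e : 'I_n -> B).
Hypothesis he : is_basis e.

Definition coord (k : 'I_n) (x : B) : A := projT1 (cid (he x)) k.

Lemma coordE x : x = \sum_i coord i x *: e i.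
Proof. by rewrite /coord; case: cid => c []. Qed.

Lemma coordU (c : 'I_n -> A) k : coord k (\sum_i c i *: e i) = c k.
Proof.
rewrite /coord; case: cid => d [_ h] /=.
rewrite (h [ffun i => c i]) ?ffunE //.
by apply: eq_bigr => i _; rewrite ffunE.
Qed.

Lemma coord_linear k : scalar (coord k).
Proof.
move=> a x y; rewrite {1}[x]coordE {1}[y]coordE scaler_sumr -big_split /=.
rewrite (eq_bigr (fun i => (a * coord i x + coord i y) *: e i)) ?coordU // => i _.
by rewrite scalerDl scalerA.
Qed.

HB.instance Definition _ k :=
  GRing.isLinear.Build A B A *%R (coord k) (coord_linear k).

Lemma coord_basis i j : coord j (e i) = (i == j)%:R.
Proof.
rewrite -(coordU (fun j => (i == j)%:R)); congr coord.
rewrite (bigD1 i) //= eqxx scale1r big1 ?addr0 // => k /negPf ki.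
by rewrite eq_sym ki scale0r.
Qed.

Variables (C : comPzRingType) (b : {rmorphism A -> C}).

(** The tensor product of [B] and [C] over [A], in coordinates along the basis
    [e].  The basis and the homomorphism are arguments of the type so that its ring
    structure, which depends on them, can be inferred. *)
Definition base_change of is_basis e & {rmorphism A -> C} : Type := {ffun 'I_n -> C}.
Local Notation D := (base_change he b).

HB.instance Definition _ := GRing.Zmodule.copy D {ffun 'I_n -> C}.

Definition bc_in (x : B) : D := [ffun k => b (coord k x)].

Definition bc_scale (c : C) (u : D) : D := [ffun k => c * u k].

Definition bc_mul (u v : D) : D :=
  \sum_i \sum_j bc_scale (u i * v j) (bc_in (e i * e j)).

Lemma bc_addE (u v : D) k : (u + v) k = u k + v k.
Proof. exact: ffunE. Qed.

Lemma bc_sumE (I : Type) (r : seq I) (P : pred I) (F : I -> D) k :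
  (\sum_(i <- r | P i) F i) k = \sum_(i <- r | P i) F i k.
Proof. exact: (@sum_ffunE _ _ I r P F k). Qed.

Lemma bc_mulE u v k :
  bc_mul u v k = \sum_i \sum_j u i * v j * b (coord k (e i * e j)).
Proof.
rewrite bc_sumE; apply: eq_bigr => i _; rewrite bc_sumE.
by apply: eq_bigr => j _; rewrite !ffunE.
Qed.

Lemma bc_mulDl : left_distributive bc_mul +%R.
Proof.
move=> u v w; apply/ffunP => k; rewrite bc_addE !bc_mulE -big_split.
apply: eq_bigr => i _; rewrite -big_split; apply: eq_bigr => j _ /=.
by rewrite bc_addE !mulrDl.
Qed.

Lemma bc_mulDr : right_distributive bc_mul +%R.
Proof.
move=> u v w; apply/ffunP => k; rewrite bc_addE !bc_mulE -big_split.
apply: eq_bigr => i _; rewrite -big_split; apply: eq_bigr => j _ /=.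
by rewrite bc_addE mulrDr mulrDl.
Qed.

Lemma bc_mul_in c d x y :
  bc_mul (bc_scale c (bc_in x)) (bc_scale d (bc_in y)) =
  bc_scale (c * d) (bc_in (x * y)).
Proof.
apply/ffunP => k; rewrite bc_mulE !ffunE.
rewrite {2}[x]coordE {2}[y]coordE mulr_suml linear_sum rmorph_sum mulr_sumr.
apply: eq_bigr => i _; rewrite mulr_sumr linear_sum rmorph_sum mulr_sumr.
apply: eq_bigr => j _; rewrite -scalerAl -scalerAr !linearZ /= !ffunE.
by rewrite !rmorphM /=; ring.
Qed.

Lemma bc_sum (u : D) : u = \sum_i bc_scale (u i) (bc_in (e i)).
Proof.
apply/ffunP => k; rewrite bc_sumE (bigD1 k) //= !ffunE coord_basis eqxx rmorph1 mulr1.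
rewrite big1 ?addr0 // => i /negPf ik.
by rewrite !ffunE coord_basis ik rmorph0 mulr0.
Qed.

(** As the product is bilinear, the ring axioms need to be checked only on multiples
    of images of elements of [B], where they follow from those of [B] by
    [bc_mul_in]. *)
Lemma bc_ind (Q : D -> Prop) : Q 0 -> (forall u v, Q u -> Q v -> Q (u + v)) ->
  (forall c x, Q (bc_scale c (bc_in x))) -> forall u, Q u.
Proof.
by move=> Q0 QD Qin u; rewrite (bc_sum u); apply: big_ind.
Qed.

Lemma bc_mul0l : left_zero 0 bc_mul.
Proof. by move=> u; apply: (addrI (bc_mul 0 u)); rewrite -bc_mulDl !addr0. Qed.

Lemma bc_mul0r : right_zero 0 bc_mul.
Proof. by move=> u; apply: (addrI (bc_mul u 0)); rewrite -bc_mulDr !addr0. Qed.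

Lemma bc_mulC : commutative bc_mul.
Proof.
elim/bc_ind => [v|u u' IHu IHu' v|c x].
- by rewrite bc_mul0l bc_mul0r.
- by rewrite bc_mulDl bc_mulDr IHu IHu'.
elim/bc_ind => [|v v' IHv IHv'|d y].
- by rewrite bc_mul0l bc_mul0r.
- by rewrite bc_mulDl bc_mulDr IHv IHv'.
by rewrite !bc_mul_in mulrC [x * y]mulrC.
Qed.

Lemma bc_mulA : associative bc_mul.
Proof.
elim/bc_ind => [v w|u u' IHu IHu' v w|c x]; first by rewrite !bc_mul0l.
  by rewrite !bc_mulDl IHu IHu'.
elim/bc_ind => [w|v v' IHv IHv' w|d y]; first by rewrite !(bc_mul0r, bc_mul0l).
  by rewrite !(bc_mulDl, bc_mulDr) IHv IHv'.
elim/bc_ind => [|w w' IHw IHw'|f z]; first by rewrite !bc_mul0r.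
  by rewrite !bc_mulDr IHw IHw'.
by rewrite !bc_mul_in !mulrA.
Qed.

Lemma bc_scale1 u : bc_scale 1 u = u.
Proof. by apply/ffunP => k; rewrite ffunE mul1r. Qed.

Lemma bc_mul1 : left_id (bc_in 1) bc_mul.
Proof.
elim/bc_ind => [|u v IHu IHv|c x]; first exact: bc_mul0r.
  by rewrite bc_mulDr IHu IHv.
by rewrite -[bc_in 1]bc_scale1 bc_mul_in !mul1r.
Qed.

HB.instance Definition _ :=
  GRing.Zmodule_isComPzRing.Build D bc_mulA bc_mulC bc_mul1 bc_mulDl.

Lemma bc_in_zmod : zmod_morphism bc_in.
Proof.
move=> x y; apply/ffunP => k; rewrite [in RHS]ffunE !ffunE.
by rewrite linearB rmorphB.
Qed.

Lemma bc_in_monoid : monoid_morphism bc_in.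
Proof.
split=> // x y; rewrite -[LHS]bc_scale1 -[bc_in x]bc_scale1 -[bc_in y]bc_scale1.
by rewrite -[RHS]/(bc_mul _ _) bc_mul_in mulr1.
Qed.

HB.instance Definition _ := GRing.isZmodMorphism.Build B D bc_in bc_in_zmod.
HB.instance Definition _ := GRing.isMonoidMorphism.Build B D bc_in bc_in_monoid.

Definition bc_cst (c : C) : D := bc_scale c (bc_in 1).

Lemma bc_cst_zmod : zmod_morphism bc_cst.
Proof. by move=> c d; apply/ffunP => k; rewrite !ffunE mulrBl. Qed.

Lemma bc_cst_monoid : monoid_morphism bc_cst.
Proof.
split=> [|c d]; first exact: bc_scale1.
by rewrite -[RHS]/(bc_mul _ _) bc_mul_in mulr1.
Qed.

HB.instance Definition _ := GRing.isZmodMorphism.Build C D bc_cst bc_cst_zmod.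
HB.instance Definition _ := GRing.isMonoidMorphism.Build C D bc_cst bc_cst_monoid.

Lemma bc_scaleE c x : bc_cst c * bc_in x = bc_scale c (bc_in x).
Proof.
rewrite -[LHS]/(bc_mul _ _) -[bc_in x in LHS]bc_scale1 bc_mul_in.
by rewrite mul1r mulr1.
Qed.

Lemma bc_expand (u : D) : u = \sum_i bc_cst (u i) * bc_in (e i).
Proof.
by rewrite {1}[u]bc_sum; apply: eq_bigr => i _; rewrite bc_scaleE.
Qed.

Lemma bc_free (c : 'I_n -> C) k : (\sum_i bc_cst (c i) * bc_in (e i)) k = c k.
Proof.
have -> : \sum_i bc_cst (c i) * bc_in (e i) = [ffun i => c i] :> D.
  by rewrite [RHS]bc_expand; apply: eq_bigr => i _; rewrite ffunE.
by rewrite ffunE.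
Qed.

Lemma base_change_pushout : is_pushout (GRing.in_alg B) b bc_in bc_cst.
Proof.
split=> [x|Q Q1 QB QM Qi Qk|E g h E10 gh].
- by apply/ffunP => k; rewrite !ffunE linearZ rmorphM.
- have QD x y : Q x -> Q y -> Q (x + y).
    move=> Qx Qy; rewrite -[y]opprK -[- y]sub0r; apply: (QB) => //.
    by apply: (QB) => //; rewrite -(subrr 1); exact: QB.
  apply: bc_ind => [|//|c x]; first by rewrite -(subrr 1); exact: QB.
  by rewrite -bc_scaleE; exact: QM.
pose l (u : D) := \sum_i h (u i) * g (e i).
have lin c x : l (bc_scale c (bc_in x)) = h c * g x.
  rewrite {2}[x]coordE rmorph_sum mulr_sumr; apply: eq_bigr => i _.
  by rewrite !ffunE -mulr_algl !rmorphM mulrA -gh.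
have lB : zmod_morphism l.
  move=> u v; rewrite -sumrB; apply: eq_bigr => i _.
  by rewrite !ffunE rmorphB mulrBl.
have l0 : l 0 = 0 by rewrite -(subrr 0) lB subrr.
have lD u v : l (u + v) = l u + l v.
  by rewrite -[v in LHS]opprK -[- v]sub0r !lB l0 sub0r opprK.
have lM : monoid_morphism l.
  split; first by rewrite -[1]bc_scale1 lin !rmorph1 mulr1.
  elim/bc_ind => [v|u u' IHu IHu' v|c x]; first by rewrite mul0r l0 mul0r.
    by rewrite mulrDl !lD IHu IHu' mulrDl.
  elim/bc_ind => [|v v' IHv IHv'|d y]; first by rewrite mulr0 l0 mulr0.
    by rewrite mulrDr !lD IHv IHv' mulrDr.
  by rewrite -[_ * _]/(bc_mul _ _) bc_mul_in !lin !rmorphM; ring.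
pose lR : {rmorphism D -> E} := HB.pack l
  (GRing.isZmodMorphism.Build D E l lB) (GRing.isMonoidMorphism.Build D E l lM).
exists lR; split=> [x|c].
  by rewrite -[LHS]/(l (bc_in x)) -[bc_in x]bc_scale1 lin rmorph1 mul1r.
by rewrite -[LHS]/(l (bc_cst c)) lin rmorph1 mulr1.
Qed.

End BaseChange.

(** * Generators of a finite free algebra *)

Section Generator.
Variables (C : comNzRingType) (D : comPzRingType) (n : nat).
Variables (k : {rmorphism C -> D}) (e : 'I_n -> D).
Hypothesis gen : forall d, exists c : 'I_n -> C, d = \sum_i k (c i) * e i.
Hypothesis free : forall c c' : 'I_n -> C,
  \sum_i k (c i) * e i = \sum_i k (c' i) * e i -> c =1 c'.
Variables (psi : {rmorphism {poly C} -> D}) (M : 'M[C]_n).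
Hypothesis psiC : forall c, psi c%:P = k c.
Hypothesis psiM : forall j : 'I_n, psi 'X ^+ j = \sum_i k (M i j) * e i.

(** Cayley-Hamilton for the multiplication by [psi 'X], of matrix [L] in the basis
    [e]: the matrix [psi 'X - L] over [D] kills the column of the [e i], so its
    determinant kills all [e i], hence 1. *)
Lemma generator_char_poly : exists L : 'M[C]_n, psi (char_poly L) = 0.
Proof.
have hL i : exists c : 'I_n -> C, psi 'X * e i = \sum_j k (c j) * e j by exact: gen.
pose L := \matrix_(i, j) projT1 (cid (hL i)) j.
have LE i : psi 'X * e i = \sum_j k (L i j) * e j.
  rewrite {1}(projT2 (cid (hL i))); apply: eq_bigr => j _.
  by rewrite mxE.
exists L; rewrite /char_poly -det_map_mx; set N := map_mx _ _.
have Ne : N *m (\col_i e i) = 0.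
  apply/matrixP => i j; rewrite !mxE.
  transitivity (\sum_i0 ((i == i0)%:R * psi 'X * e i0 - k (L i i0) * e i0)).
    apply: eq_bigr => l _; rewrite !mxE rmorphB psiC mulrBl; congr (_ * _ - _).
    by rewrite rmorphMn /= -mulr_natl.
  rewrite sumrB -LE (bigD1 i) //= eqxx mul1r big1 ?addr0 ?subrr // => l /negPf il.
  by rewrite eq_sym il !mul0r.
have dete i : \det N * e i = 0.
  have : (\adj N *m (N *m (\col_i e i))) i 0 = 0 by rewrite Ne mulmx0 mxE.
  by rewrite mulmxA mul_adj_mx mul_scalar_mx !mxE.
have [c one] := gen 1.
rewrite -[\det N]mulr1 one mulr_sumr big1 // => i _.
by rewrite mulrCA dete mulr0.
Qed.

Lemma generator_span p : exists c : 'I_n -> C, psi p = \sum_j k (c j) * psi 'X ^+ j.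
Proof.
have [L L0] := generator_char_poly.
have monL := char_poly_monic L.
have := Pdiv.RingMonic.rdivp_eq monL p.
set q := Pdiv.Ring.rdivp _ _; set r := Pdiv.Ring.rmodp _ _ => pE.
have sr : (size r <= n)%N.
  by rewrite -ltnS -(size_char_poly L) Pdiv.Ring.ltn_rmodpN0 // monic_neq0.
exists (fun j => r`_j); rewrite pE rmorphD rmorphM L0 mulr0 add0r.
rewrite -[r in LHS](coefK r) poly_def.
rewrite -(big_mkord xpredT (fun i => r`_i *: 'X^i)).
rewrite -(big_mkord xpredT (fun i => k r`_i * psi 'X ^+ i)).
rewrite rmorph_sum (big_cat_nat (leq0n _) sr) /= [X in _ = _ + X]big1_seq ?addr0.
  by apply: eq_bigr => i _; rewrite -mul_polyC rmorphM psiC rmorphXn.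
move=> i /andP[_]; rewrite mem_index_iota => /andP[ri _].
by rewrite nth_default // rmorph0 mul0r.
Qed.

(** By Cayley-Hamilton the powers [psi 'X ^+ j] with [j < n] generate the image
    of [psi] as a module, and [M] expresses them in the basis [e]. *)
Lemma generator_det : (forall d, exists p, d = psi p) <-> invertible (\det M).
Proof.
split=> [surj|[c Mc] d].
  have hN l : exists c : 'I_n -> C, e l = \sum_j k (c j) * psi 'X ^+ j.
    by have [p ->] := surj (e l); exact: generator_span.
  pose N := \matrix_(j, l) projT1 (cid (hN l)) j.
  have NE l : e l = \sum_j k (N j l) * psi 'X ^+ j.
    rewrite {1}(projT2 (cid (hN l))); apply: eq_bigr => j _.
    by rewrite mxE.
  exists (\det N); rewrite -det_mulmx (_ : M *m N = 1%:M) ?det1 //.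
  apply/matrixP => i l.
  apply: (free (c := fun i => (M *m N) i l) (c' := fun i => 1%:M i l)).
  transitivity (e l).
    rewrite [RHS]NE.
    transitivity (\sum_i0 \sum_j k (N j l) * (k (M i0 j) * e i0)).
      apply: eq_bigr => h _; rewrite mxE rmorph_sum mulr_suml.
      by apply: eq_bigr => j _; rewrite rmorphM; ring.
    by rewrite exchange_big; apply: eq_bigr => j _; rewrite psiM mulr_sumr.
  rewrite (bigD1 l) //= mxE eqxx rmorph1 mul1r big1 ?addr0 // => h /negPf hl.
  by rewrite mxE hl rmorph0 mul0r.
have he l : exists p, e l = psi p.
  exists (\sum_j (c * \adj M j l)%:P * 'X^j); rewrite rmorph_sum.
  transitivity (\sum_i k (1%:M i l) * e i).
    rewrite (bigD1 l) //= mxE eqxx rmorph1 mul1r big1 ?addr0 // => h /negPf hl.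
    by rewrite mxE hl rmorph0 mul0r.
  transitivity (\sum_i \sum_j k (c * \adj M j l) * (k (M i j) * e i)).
    apply: eq_bigr => i _.
    have -> : 1%:M = c *: (M *m \adj M) by rewrite mul_mx_adj scale_scalar_mx mulrC Mc.
    rewrite !mxE mulr_sumr rmorph_sum mulr_suml.
    by apply: eq_bigr => j _; rewrite !rmorphM; ring.
  rewrite exchange_big; apply: eq_bigr => j _.
  by rewrite -mulr_sumr -psiM [RHS]rmorphM rmorphXn psiC.
have [b ->] := gen d.
exists (\sum_i (b i)%:P * projT1 (cid (he i))); rewrite rmorph_sum.
apply: eq_bigr => i _; rewrite rmorphM psiC; congr (_ * _).
exact: (projT2 (cid (he i))).
Qed.

End Generator.

(** * Monogenerators *)

Section Monogenerator.
Variables (A : comNzRingType) (B : comAlgType A) (n : nat) (e : 'I_n -> B).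
Hypothesis he : is_basis e.

Variables (T : lrspace) (tau : lrmor T (Spec A)).
Variables (S'T : fibre_product (Spec_map (GRing.in_alg B)) tau).
Variables (A1T : fibre_product (Spec_map (@polyC A)) tau).
Variables (m : lrmor S'T A1T) (phi : lrmor T (Spec {mpoly A[n]})).
Hypothesis schT : is_scheme T.
Hypothesis mT : lrcomp (fp2 A1T) m = fp2 S'T.
Hypothesis phiT : lrcomp (Spec_map (@mpolyC n A)) phi = tau.
Hypothesis mphi : corresponds e m phi.

(** Over an affine open [Spec C] of [T], where [phi] is given by a homomorphism
    [c], the morphism [m] is given by the map [C[t] -> B_C] that sends [t] to the
    specialization of [theta] along [c].  All the homomorphisms involved are
    obtained from morphisms of spectra by full faithfulness, and the equations that
    relate [m] to [phi] determine their values on generators. *)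
Lemma monogenerator_local x : exists (U : set T) (C : comNzRingType)
    (j : lrmor (Spec C) T) (c : {rmorphism {mpoly A[n]} -> C})
    (D : comPzRingType) (psi : {rmorphism {poly C} -> D}) v u,
  [/\ chart j U, U x, lrcomp phi j = Spec_map c,
      affine_over m (fp2 A1T @^-1` U) psi v u &
      (forall d, exists p, d = psi p) <-> invertible (c (local_index_form e))].
Proof.
have [C0 [j [U [jU Ux]]]] := (scheme_chart T).1 schT x.
have [y _] := chart_surj jU Ux.
have [C CE] : exists C : comNzRingType, C0 = C :> comPzRingType.
  apply: comNz_of => e10; apply: (@prime1 _ y).
  by rewrite e10; exact: prime0.
subst C0; have [c cE] := Spec_map_full (lrcomp phi j).
pose b : {rmorphism A -> C} := c \o @mpolyC n A.
have tauE : lrcomp tau j = Spec_map b.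
  by rewrite -phiT -lrcompA cE Spec_map_comp.
have poB := base_change_pushout he b.
have [u [u1 u2 uU]] := fibre_chart poB S'T jU tauE.
have [v [v1 v2 vU]] := fibre_chart (poly_pushout b) A1T jU tauE.
have mW : m @^-1` (fp2 A1T @^-1` U) = fp2 S'T @^-1` U by rewrite -mT.
have muU z : (fp2 A1T @^-1` U) (lrcomp m u z).
  rewrite /preimage /= -[fp2 _ _]/(lrcomp (fp2 A1T) m (u z)) mT.
  by have [uU1 _ _] := uU; exact: uU1.
have [l [_ [vl _ _ _]]] := chart_inv vU (chart_open vU).
have [psi psiE] := Spec_map_full (lrcomp l (open_fact (chart_open vU) muU)).
have sq : lrcomp m u = lrcomp v (Spec_map psi).
  by rewrite -psiE lrcompA vl open_factK.
pose D := base_change he b.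
pose k : {rmorphism C -> D} := bc_cst he b.
pose i : {rmorphism B -> D} := bc_in he b.
have psiC q : psi q%:P = k q.
  move: q; apply: (@Spec_map_faithful _ _ (psi \o @polyC C) k).
  rewrite -Spec_map_comp; have [_ jm _] := jU; apply: jm.
  by rewrite lrcompA -v2 -lrcompA -sq lrcompA mT.
have [phiS [phiA [eS1 eS2 eA1 eA2 univ]]] := mphi.
have [beta betaE] := Spec_map_full (lrcomp phiS u).
have [alpha alphaE] := Spec_map_full (lrcomp phiA v).
have betaB q : beta q%:MP = i q.
  move: q; apply: (@Spec_map_faithful _ _ (beta \o @mpolyC n B) i).
  by rewrite -Spec_map_comp -betaE lrcompA eS1.
have betaA q : beta (ext_hom B n q) = k (c q).
  move: q; apply: (@Spec_map_faithful _ _ (beta \o ext_hom B n) (k \o c)).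
  by rewrite -!Spec_map_comp -betaE lrcompA eS2 -lrcompA u2 lrcompA cE.
have alphaX : alpha 'X = 'X.
  have := @Spec_map_faithful _ _ (alpha \o map_poly (@mpolyC n A)) (map_poly b).
  move=> /(_ _ 'X) /=; rewrite !map_polyX; apply.
  by rewrite -Spec_map_comp -alphaE lrcompA eA1.
have psiX : psi 'X = beta (theta e).
  rewrite -alphaX.
  have : lrcomp (Spec_map alpha) (Spec_map psi) =
         lrcomp (Spec_map (univ_hom e)) (Spec_map beta).
    by rewrite -alphaE -betaE lrcompA univ -!lrcompA sq.
  rewrite !Spec_map_comp => /Spec_map_faithful /(_ 'X) /= ->.
  by rewrite /univ_hom /= horner_morphX.
exists U, C, j, c, D, psi, v, u; split=> //.
  by split=> //; rewrite mW.
have dE : c (local_index_form e) = \det (map_mx c (coefficient_matrix e)).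
  by rewrite det_map_mx.
rewrite dE; apply: (@generator_det _ _ _ k (fun q => i (e q))) => //.
- by move=> d; exists (fun q => d q); exact: bc_expand.
- by move=> d d' dd q; rewrite -(bc_free he b d) -(bc_free he b d') dd.
move=> q; rewrite psiX -rmorphXn (coefficient_matrixP he) rmorph_sum.
by apply: eq_bigr => r _; rewrite rmorphM betaA betaB mxE.
Qed.

(** The element [c (local_index_form e)] is a unit iff it lies in no prime of [C],
    that is, iff [phi] maps [Spec C] to [D(local_index_form e)]. *)
Lemma monogeneratorP :
  closed_immersion m <-> forall x, basic_open (local_index_form e) (phi x).
Proof.
split=> [cl x|phiD].
  have [U [C [j [c [D [psi [v [u [jU Ux cE sq surj]]]]]]]]] := monogenerator_local x.
  have [y <-] := chart_surj jU Ux.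
  have [d cd] := surj.1 (closed_immersion_surj cl sq).
  rewrite -[phi (j y)]/(lrcomp phi j y) cE => yc.
  by apply: (@prime1 _ y); rewrite -cd mulrC; exact: primeMr.
apply: closed_immersion_local => z.
have [U [C [j [c [D [psi [v [u [jU Ux cE sq surj]]]]]]]]] :=
  monogenerator_local (fp2 A1T z).
exists (fp2 A1T @^-1` U), {poly C}, D, psi, v, u; split=> //.
apply/surj; apply: prime_unit => y yc; apply: (phiD (j y)).
by rewrite -[phi (j y)]/(lrcomp phi j y) cE.
Qed.

End Monogenerator.

Theorem proposition3p6 (A : comNzRingType) (B : comAlgType A) (n : nat)
    (e : 'I_n -> B) :
  noetherian_ring A -> (0 < n)%N -> is_basis e ->
  is_monogenerator_subscheme e (distinguished_incl (local_index_form e)).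
Proof.
move=> _ _ he T tau S'T A1T m phi schT mT phiT mphi.
rewrite (monogeneratorP he schT mT phiT mphi).
split=> [phiD|[psi <-] x]; last exact: open_incl_mem.
exists (@open_fact (Spec _) _ (basic_open_open (local_index_form e)) _ _ phiD).
exact: open_factK.
Qed.
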